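(* Let $N\ge2$, $\min\{H_1,\dots,H_N\}>\frac14$, and let $B^{H_1},\dots,B^{H_N}$ be independent fractional Brownian motions on $[0,T]$ with Hurst parameters $H_1,\dots,H_N$. For $i\ne j$, the mixed signature term $\int_s^t\int_s^{t_2}dB_{t_1}^{H_i}\otimes dB_{t_2}^{H_j}$ satisfies: there is a constant $C>0$ such that for all $0\le s\le t\le T$, $$\mathbb{E}\left[\left|\int_s^t\int_s^{t_2}dB_{t_1}^{H_i}\otimes dB_{t_2}^{H_j}\right|^2\right]\le C\,|t-s|^{2(H_i+H_j)}.$$
   Context: Each $B^{H_k}$ is an $\mathbb{R}^d$-valued fractional Brownian motion with independent components of Hurst parameter $H_k\in(0,1)$ (each component centred Gaussian with covariance $\frac12(t^{2H_k}+s^{2H_k}-|t-s|^{2H_k})$). The iterated integral is understood in the rough path sense, i.e. as the limit as $m\to\infty$ of $\int_s^t(B^{H_i,m}_u-B^{H_i,m}_s)\otimes dB^{H_j,m}_u$, where $B^{H_k,m}$ is the continuous path agreeing with $B^{H_k}$ at the points $l2^{-m}T$, $l=0,\dots,2^m$, and affine between consecutive ones. *)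

(* Defs.v *)
From HB Require Import structures.
From mathcomp Require Import all_boot all_order all_algebra.
From mathcomp Require Import all_classical all_reals all_analysis.
Set Implicit Arguments.
Unset Strict Implicit.
Unset Printing Implicit Defensive.
Import Order.TTheory GRing.Theory Num.Theory.
Import numFieldNormedType.Exports.
Local Open Scope classical_set_scope.
Local Open Scope ring_scope.

Section GaussianProcesses.
Context {disp : measure_display} {Omega : measurableType disp} {R : realType}.
Variable P : probability Omega R.

(* Constants count as Gaussian; they have to be listed separately because
   [normal_prob m 0] is by convention a uniform law in the library. *)
Definition gaussian_rv (X : Omega -> R) : Prop :=
  (exists m : R, forall U : set R, measurable U ->
     P (X @^-1` U) = \d_m U) \/
  (exists m s : R, 0 < s /\ forall U : set R, measurable U ->
     P (X @^-1` U) = normal_prob m s U).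

Definition gaussian_process (D : set R) (X : R -> Omega -> R) : Prop :=
  forall (n : nat) (t c : 'I_n -> R), (forall l, D (t l)) ->
    gaussian_rv (fun w => \sum_(l < n) c l * X (t l) w).

Definition generated_sigma_algebra (I : Type) (D : set I)
    (X : I -> Omega -> R) : set (set Omega) :=
  <<s \bigcup_(i in D) preimage_set_system setT (X i) measurable >>.

(* Every generated sigma-algebra contains the whole space, so the product rule
   over the full finite index type [K] covers all subfamilies of [K]. *)
Definition independent_families (K : finType) (I : Type) (D : set I)
    (X : K -> I -> Omega -> R) : Prop :=
  forall A : K -> set Omega,
    (forall k, generated_sigma_algebra D (X k) (A k)) ->
    P (\bigcap_k A k) = (\prod_(k : K) P (A k))%E.

Definition fractional_brownian_motion (T H : R) (d : nat)
    (B : R -> 'I_d -> {RV P >-> R}) : Prop :=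
  [/\ forall a, gaussian_process `[0, T] (fun t => B t a),
      forall t a, 0 <= t <= T -> ('E_P[B t a] = 0)%E,
      forall s t a, 0 <= s <= T -> 0 <= t <= T ->
        covariance P (B s a) (B t a) =
        (2^-1 * (t `^ (2 * H) + s `^ (2 * H) - `|t - s| `^ (2 * H)))%:E &
      independent_families `[0, T] (fun a t => B t a)].

Definition independent_processes (T : R) (N d : nat)
    (B : 'I_N -> R -> 'I_d -> {RV P >-> R}) : Prop :=
  independent_families [set ta : R * 'I_d | 0 <= ta.1 <= T]
    (fun k ta => B k ta.1 ta.2).

Definition sample_path (d : nat) (B : R -> 'I_d -> {RV P >-> R}) (w : Omega) :
    R -> 'rV[R]_d :=
  fun t => \row_a B t a w.

End GaussianProcesses.

Section IteratedIntegrals.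
Context {R : realType} {d : nat}.

(* For u in [0, T[ only values of x at grid points of [0, T] enter; at u = T
   the value x (T + T / 2^m) is multiplied by 0. *)
Definition dyadic_interpolation (T : R) (m : nat) (x : R -> 'rV[R]_d) :
    R -> 'rV[R]_d :=
  fun u =>
    let h := T / 2 ^+ m in
    let l : R := (Num.floor (u / h))%:~R in
    x (l * h) + (u / h - l) *: (x ((l + 1) * h) - x (l * h)).

(* The integral of (x_u - x_s) (x) dy_u over [s, t] for a piecewise affine y,
   as the Lebesgue integral against y' du; the finitely many points of [s, t]
   where y is not differentiable are negligible. *)
Definition iterated_integral (x y : R -> 'rV[R]_d) (s t : R) : 'M[R]_d :=
  \matrix_(a, b) (\int[lebesgue_measure]_(u in `[s, t])
     ((x u 0 a - x s 0 a) * derive1 (fun v => y v 0 b) u)).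

Definition dyadic_iterated_integral (T : R) (x y : R -> 'rV[R]_d) (s t : R)
    (m : nat) : 'M[R]_d :=
  iterated_integral (dyadic_interpolation T m x) (dyadic_interpolation T m y)
    s t.

Definition rough_iterated_integral (T : R) (x y : R -> 'rV[R]_d) (s t : R) :
    'M[R]_d :=
  lim (dyadic_iterated_integral T x y s t m @[m --> \oo]).

(* Euclidean norm on R^d (x) R^d; the library norm on matrices is the max norm. *)
Definition tensor_norm (A : 'M[R]_d) : R :=
  Num.sqrt (\sum_(a < d) \sum_(b < d) A a b ^+ 2).

End IteratedIntegrals.

(* Main.v *)
Require Import Defs.
From HB Require Import structures.
From mathcomp Require Import all_boot all_order all_algebra.
From mathcomp Require Import all_classical all_reals all_analysis.
From mathcomp Require Import measurable_realfun ring lra zify.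
Import Order.TTheory GRing.Theory Num.Theory.
Import numFieldNormedType.Exports.
Import HBNNSimple.
Local Open Scope classical_set_scope.
Local Open Scope ring_scope.

(** Only the covariances of the two processes matter.  On the grid of step
    [h = T / 2^m] the polygonal integral over [s, t] is the sum
    [sum ((x_l + x_(l+1)) / 2 - x_p) (y_(l+1) - y_l)] over the full cells inside
    [s, t], plus a few products of single increments coming from the two
    partial cells.  Halving the step changes the sum over full cells by half the
    sum of the areas [X_(a,b) Y_(b,c) - X_(b,c) Y_(a,b)] of the coarse cells.
    By independence the second moment of that sum is a double sum of products
    of increment covariances of X and of Y: if one Hurst parameter is at most
    1/2, concavity of [u^(2H)] makes its covariances absolutely summable, and
    otherwise [H_i + H_j > 1] and the trivial bound suffices.  Hence, with
    [tau = t - s], [E |I^(m+1) - I^m|^2 <= C tau^(2 (H_i + H_j)) (h / tau)^eps]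
    as soon as [h <= tau], while [E |I^m|^2 <= C tau^(2 (H_i + H_j))] at the
    first such level.  A weighted Cauchy-Schwarz inequality then gives both the
    almost sure convergence and the bound on the limit. *)

(** * Integration and independence *)

(* [f] is not assumed measurable: the limit defining the rough integral takes a
   junk value off the set of convergence. *)
Lemma le_integral_ae_nonmeasurable (R : realType) (disp : measure_display)
    (Omega : measurableType disp) (mu : {measure set Omega -> \bar R})
    (f g : Omega -> \bar R) :
  (forall w, (0 <= f w)%E) -> (forall w, (0 <= g w)%E) ->
  measurable_fun setT g -> {ae mu, forall w, (f w <= g w)%E} ->
  (\int[mu]_w f w <= \int[mu]_w g w)%E.
Proof.
move=> f0 g0 mg fg; rewrite ge0_integralTE//.
apply/ge_ereal_sup => _ /= [h hf <-].
rewrite -integralT_nnsfun; apply: ae_ge0_le_integral => //.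
- by move=> w _; rewrite lee_fin; apply: fun_ge0.
- exact/measurable_EFinP.
- by apply: filterS fg => w fgw _; exact: le_trans (hf w) fgw.
Qed.

(** Independence says that the joint law of [(f, g)] and the product of the marginal laws agree on
    rectangles, hence are equal. Fubini for [z.1 * z.2] under the product law then splits the
    integral. *)
Lemma integral_mul_independent (R : realType) (disp : measure_display)
    (Omega : measurableType disp) (P : probability Omega R)
    (f g : {mfun Omega >-> R}) :
  (forall A B : set R, measurable A -> measurable B ->
     P ((f @^-1` A) `&` (g @^-1` B)) = (P (f @^-1` A) * P (g @^-1` B))%E) ->
  P.-integrable setT (EFin \o f) -> P.-integrable setT (EFin \o g) ->
  P.-integrable setT (fun w => (f w * g w)%:E) /\
  (\int[P]_w (f w * g w)%:E = (\int[P]_w (f w)%:E) * (\int[P]_w (g w)%:E))%E.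
Proof.
move=> indep If Ig.
have mfg : measurable_fun setT (fun w => (f w, g w)).
  by apply/measurable_fun_pairP; split => //=.
pose fg : {mfun Omega >-> (R * R)%type} := mfun_Sub (mem_set mfg).
have prodE : forall X, measurable X ->
    (distribution P f \x distribution P g)%E X = distribution P fg X.
  apply: product_measure_unique => A B mA mB.
  by rewrite /distribution /pushforward -indep.
pose F := fun z : R * R => (z.1 * z.2)%:E.
have mF : measurable_fun setT F.
  by apply/measurable_EFinP; apply: measurable_funM.
have absI (h : {mfun Omega >-> R}) : P.-integrable setT (EFin \o h) ->
  (\int[distribution P h]_y `|y%:E| < +oo)%E.
  move=> /integrableP[_]; rewrite ge0_integral_pushforward//.
  exact: measurableT_comp.
have FI : (distribution P f \x distribution P g)%E.-integrable setT F.
  apply/integrable12ltyP => //.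
  rewrite (_ : (fun x => _) =
     (fun x => `|x%:E| * \int[distribution P g]_y `|y%:E|)%E); last first.
    apply/funext => x.
    rewrite -ge0_integralZl//; last exact: measurableT_comp.
    by apply: eq_integral => y _; rewrite /F EFinM abseM.
  rewrite ge0_integralZr//; last 2 first.
  - exact: measurableT_comp.
  - by apply: integral_ge0.
  by rewrite lte_mul_pinfty ?integral_ge0 ?absI// ge0_fin_numE ?integral_ge0 ?absI.
have FI' : P.-integrable setT (F \o fg).
  apply/integrableP; split; first exact: measurableT_comp.
  have /integrableP[_] := FI.
  rewrite (eq_measure_integral (distribution P fg)); last first.
    by move=> A mA _; exact: prodE.
  rewrite ge0_integral_pushforward//.
  exact: measurableT_comp.
split => //.
rewrite -[LHS]/(\int[P]_(w in fg @^-1` setT) (F \o fg) w)%E.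
rewrite -integral_pushforward//.
rewrite -/(distribution P fg).
rewrite (eq_measure_integral (distribution P f \x distribution P g)%E); last first.
  by move=> A mA _; apply/esym; exact: prodE.
rewrite -integral12_prod_meas1//.
have idI (h : {mfun Omega >-> R}) : P.-integrable setT (EFin \o h) ->
  (distribution P h).-integrable setT EFin.
  by move=> Ih; apply: integrable_pushforward.
have idE (h : {mfun Omega >-> R}) : P.-integrable setT (EFin \o h) ->
  (\int[distribution P h]_y y%:E = \int[P]_w (h w)%:E)%E.
  by move=> Ih; rewrite integral_pushforward.
rewrite /fubini_F.
under eq_integral => x _ do under eq_integral => y _ do rewrite /F EFinM /=.
under eq_integral do rewrite integralZl ?idI//=.
have fin : (\int[distribution P g]_y y%:E)%E \is a fin_num.
  by apply: integrable_fin_num => //; exact: idI.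
under eq_integral do rewrite -(fineK fin) //.
rewrite integralZr ?idI//=.
by rewrite fineK// !idE.
Qed.

(** * Convergence from weighted increments *)

Lemma geometric_sum_le (R : realType) (r : R) (n : nat) : 0 < r < 1 ->
  \sum_(k < n) r ^+ k <= (1 - r)^-1.
Proof.
move=> /andP[r0 r1]; rewrite -[leRHS]mul1r ler_pdivlMr ?subr_gt0//.
rewrite mulrC -opprB mulNr -subrX1 opprB lerBlDr lerDl.
by rewrite exprn_ge0// ltW.
Qed.

(* Weighted Cauchy-Schwarz, in the form
   [(z 0 + sum D_k)^2 <= (1 + sum r^k) (z 0 ^2 + sum r^-k D_k^2)]. *)
Lemma sqr_le_weighted_increments (R : realType) (z : nat -> R) (r : R) (n : nat) :
  0 < r ->
  z n ^+ 2 <= (1 + \sum_(k < n) r ^+ k) *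
    (z 0%N ^+ 2 + \sum_(k < n) r ^- k * (z k.+1 - z k) ^+ 2).
Proof.
move=> r0; elim: n => [|n IH]; first by rewrite !big_ord0 !addr0 mul1r.
rewrite !big_ord_recr/=.
set c := \sum_(k < n) _ in IH *; set Q := \sum_(k < n) _ in IH *.
have c0 : 0 <= c by apply: sumr_ge0 => k _; rewrite exprn_ge0// ltW.
set D := z n.+1 - z n.
have -> : z n.+1 = z n + D by rewrite addrC subrK.
set e := r ^+ n; have e0 : 0 < e by rewrite exprn_gt0.
have c1 : 0 < 1 + c by rewrite ltr_pwDl.
set q := z 0%N ^+ 2 + Q in IH *.
have key : (z n + D) ^+ 2 <= (1 + c + e) * (z n ^+ 2 / (1 + c) + e^-1 * D ^+ 2).
  rewrite -subr_ge0.
  have -> : (1 + c + e) * (z n ^+ 2 / (1 + c) + e^-1 * D ^+ 2) - (z n + D) ^+ 2 =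
     (e * z n - (1 + c) * D) ^+ 2 / (e * (1 + c)).
    by field; rewrite !gt_eqF.
  by rewrite divr_ge0 ?sqr_ge0// ltW// mulr_gt0.
apply: (le_trans key); rewrite !addrA ler_pM2l; last by rewrite addr_gt0.
by rewrite lerD2r ler_pdivrMr// mulrC.
Qed.

(** With [D] the k-th increment, [2 * |D| <= r ^+ k + r ^- k * D ^+ 2] makes the increments
    absolutely summable; the bound on the limit is the weighted Cauchy-Schwarz inequality, uniform
    in [n]. *)
Lemma cvg_of_weighted_increments (R : realType) (z : nat -> R) (r Q : R) :
  0 < r < 1 ->
  (forall n, z 0%N ^+ 2 + \sum_(k < n) r ^- k * (z k.+1 - z k) ^+ 2 <= Q) ->
  cvgn z /\ (limn z) ^+ 2 <= (1 + (1 - r)^-1) * Q.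
Proof.
move=> r01 hQ; have /andP[r0 r1] := r01.
have zcvg : cvgn z.
  have ->: z = series (telescope z) + cst (z 0%N).
    by apply/funext => n; rewrite /= telescopeK /= subrK.
  apply: is_cvgD; last exact: is_cvg_cst.
  apply: normed_cvg; apply: nondecreasing_is_cvgn.
    by apply: nondecreasing_series => n _ _; exact: normr_ge0.
  exists (2^-1 * ((1 - r)^-1 + Q)) => _ [n _ <-].
  apply: (@le_trans _ _
    (\sum_(k < n) (2^-1 * (r ^+ k + r ^- k * (z k.+1 - z k) ^+ 2)))).
    rewrite /= /series /= big_mkord; apply: ler_sum => k _.
    rewrite /telescope /=; set D := z k.+1 - z k; set e := r ^+ k.
    have e0 : 0 < e by rewrite exprn_gt0.
    rewrite -subr_ge0 -[D ^+ 2]real_normK ?num_real//.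
    have -> : 2^-1 * (e + e^-1 * `|D| ^+ 2) - `|D| = (e - `|D|) ^+ 2 / (2 * e).
      by field; rewrite gt_eqF.
    by rewrite divr_ge0 ?sqr_ge0// mulr_ge0// ltW.
  rewrite -mulr_sumr ler_pM2l// big_split /= lerD ?geometric_sum_le//.
  apply: le_trans (hQ n); by rewrite lerDr sqr_ge0.
have zle n : z n ^+ 2 <= (1 + (1 - r)^-1) * Q.
  apply: (le_trans (sqr_le_weighted_increments _ z r n r0)).
  apply: ler_pM => //.
  - by rewrite addr_ge0// sumr_ge0// => k _; rewrite exprn_ge0// ltW.
  - rewrite addr_ge0 ?sqr_ge0// sumr_ge0// => k _.
    by rewrite mulr_ge0 ?sqr_ge0// invr_ge0 exprn_ge0// ltW.
  - by rewrite lerD2l geometric_sum_le.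
split=> //.
have z2 : z n ^+ 2 @[n --> \oo] --> limn z ^+ 2 by apply: cvgM; exact: zcvg.
rewrite -(cvg_lim _ z2)//.
apply: limr_le; first by apply: cvgP z2.
by near=> n; exact: zle.
Unshelve. all: by end_near. Qed.

(** [S] is a multiple of the series of weighted squared increments. Its k-th increment has mean at
    most [r ^- k * V * (r ^+ 2) ^+ k = V * r ^+ k], so the means are summable. The conclusion is
    phrased through this measurable majorant, which controls the limit wherever it is finite. *)
Lemma ae_cvg_of_geometric_increments (R : realType) (disp : measure_display)
    (Omega : measurableType disp) (mu : {measure set Omega -> \bar R})
    (Z : nat -> Omega -> R) (r V : R) :
  0 < r < 1 -> 0 <= V ->
  (forall n, measurable_fun setT (Z n)) ->
  (\int[mu]_w (Z 0%N w ^+ 2)%:E <= V%:E)%E ->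
  (forall n, \int[mu]_w ((Z n.+1 w - Z n w) ^+ 2)%:E <= (V * (r ^+ 2) ^+ n)%:E)%E ->
  exists S : Omega -> \bar R,
    [/\ measurable_fun setT S, (forall w, (0 <= S w)%E),
        (\int[mu]_w S w <= ((1 + (1 - r)^-1) ^+ 2 * V)%:E)%E &
        forall w, (S w < +oo)%E ->
          cvg (Z n w @[n --> \oo]) /\
          (((limn (Z ^~ w)) ^+ 2)%:E <= S w)%E].
Proof.
move=> r01 V0 mZ Z0 ZD; have /andP[r0 r1] := r01.
pose t k w := if k is k'.+1 then r ^- k' * (Z k'.+1 w - Z k' w) ^+ 2
              else Z 0%N w ^+ 2.
have t0 k w : 0 <= t k w.
  case: k => [|k]; rewrite /t ?sqr_ge0// mulr_ge0 ?sqr_ge0//.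
  by rewrite invr_ge0 exprn_ge0// ltW.
have mt k : measurable_fun setT (t k).
  case: k => [|k]; rewrite /t; first exact: measurable_funX.
  apply: measurable_funM => //; apply: measurable_funX; exact: measurable_funB.
pose c := 1 + (1 - r)^-1.
have c0 : 0 < c by rewrite ltr_pwDl// invr_ge0 subr_ge0 ltW.
pose S w := (c%:E * \sum_(k <oo) (t k w)%:E)%E.
have s0 w : (0 <= \sum_(k <oo) (t k w)%:E)%E.
  by apply: nneseries_ge0 => k _ _; rewrite lee_fin.
have mS : measurable_fun setT (fun w => \sum_(k <oo) (t k w)%:E)%E.
  apply: ge0_emeasurable_sum => [k w _ _|k _]; first by rewrite lee_fin.
  exact/measurable_EFinP.
exists S; split.
- exact: measurable_funeM.
- by move=> w; rewrite mule_ge0// lee_fin ltW.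
- rewrite ge0_integralZl// ?lee_fin ?(ltW c0)//.
  rewrite integral_nneseries//; last 2 first.
    by move=> k; exact/measurable_EFinP.
    by move=> k w _; rewrite lee_fin.
  rewrite expr2 -mulrA EFinM; apply: lee_wpmul2l => //.
    by rewrite lee_fin ltW.
  apply: lime_le.
    by apply: is_cvg_nneseries => k _ _; apply: integral_ge0 => w _; rewrite lee_fin.
  near=> n.
  apply: (@le_trans _ _ (\sum_(0 <= k < n.+1) (\int[mu]_w (t k w)%:E))%E).
    rewrite big_nat_recr//= leeDl// integral_ge0// => w _; by rewrite lee_fin.
  rewrite big_nat_recl// /c mulrDl mul1r EFinD; apply: leeD => //.
  apply: (@le_trans _ _ (\sum_(k < n) (V * r ^+ k)%:E)%E).
    rewrite big_mkord; apply: lee_sum => k _; rewrite /t.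
    under eq_integral do rewrite EFinM.
    rewrite ge0_integralZl//; last 3 first.
    - apply/measurable_EFinP/measurable_funX; exact: measurable_funB.
    - by move=> w _; rewrite lee_fin sqr_ge0.
    - by rewrite lee_fin invr_ge0 exprn_ge0// ltW.
    apply: (@le_trans _ _ ((r ^- k)%:E * (V * (r ^+ 2) ^+ k)%:E)%E).
      by rewrite lee_pmul2l ?lte_fin ?invr_gt0 ?exprn_gt0.
    rewrite -EFinM lee_fin -exprM mulnC exprM expr2.
    have ek : r ^+ k != 0 by rewrite expf_neq0// gt_eqF.
    by rewrite le_eqVlt; apply/orP; left; apply/eqP; field.
  rewrite sumEFin lee_fin -mulr_sumr mulrC ler_wpM2r//.
  exact: geometric_sum_le.
- move=> w Sw.
  have sw : (\sum_(k <oo) (t k w)%:E)%E \is a fin_num.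
    rewrite ge0_fin_numE// ltey; apply: contraTneq Sw => h.
    by rewrite /S h gt0_muley ?lte_fin// ltxx.
  have [|zc zl] := @cvg_of_weighted_increments _ (Z ^~ w) r
      (fine (\sum_(k <oo) (t k w)%:E)%E) r01.
    move=> n; rewrite -lee_fin fineK//.
    have -> : Z 0%N w ^+ 2 + \sum_(k < n) r ^- k * (Z k.+1 w - Z k w) ^+ 2 =
      \sum_(0 <= k < n.+1) t k w by rewrite big_nat_recl// big_mkord.
    rewrite -sumEFin; apply: nneseries_lim_ge => k _ _; by rewrite lee_fin.
  split=> //; rewrite /S -(fineK sw) -EFinM lee_fin; exact: zl.
Unshelve. all: by end_near. Qed.

(** * Integrals of polygonal paths *)

(** Integrability and value travel together, so that adjacent intervals can be glued without
    separate side conditions. *)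
Definition has_Rintegral (R : realType) (f : R -> R) (a b v : R) : Prop :=
  (@lebesgue_measure R).-integrable `[a, b] (EFin \o f) /\
  (\int[@lebesgue_measure R]_(u in `[a, b]) f u) = v.

Lemma has_RintegralD (R : realType) (f : R -> R) (a b c v w : R) :
  a <= b -> b <= c -> has_Rintegral R f a b v -> has_Rintegral R f b c w ->
  has_Rintegral R f a c (v + w).
Proof.
move=> ab bc [iab <-] [ibc <-].
have E : `[a, c]%classic = `[a, b[ `|` `[b, c].
  by rewrite -itv_bndbnd_setU// bnd_simp.
have dj : [disjoint `[a, b[%classic & `[b, c]%classic].
  apply/disj_setPS => y [/=]; rewrite !in_itv/= => /andP[_ yb] /andP[].
  by rewrite leNgt yb.
have iab' : (@lebesgue_measure R).-integrable `[a, b[ (EFin \o f).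
  by apply: integrableS iab => //; apply: subset_itvl; rewrite bnd_simp.
have iac : (@lebesgue_measure R).-integrable (`[a, b[ `|` `[b, c]) (EFin \o f).
  have m1 := measurable_int _ iab'; have m2 := measurable_int _ ibc.
  have m12 : measurable_fun (`[a, b[ `|` `[b, c]) (EFin \o f).
    by apply/measurable_funU.
  apply/integrableP; split => //.
  rewrite ge0_integral_setU//; last exact: measurableT_comp.
  by apply: lte_add_pinfty; [case/integrableP : iab'|case/integrableP : ibc].
split; first by rewrite E.
by rewrite E Rintegral_setU// Rintegral_itv_bndo_bndc.
Qed.

(** The formula for [f] is asked on the open interval only, because a polygonal path need not be
    differentiable at its nodes; the value is the midpoint rule, exact for affine functions. *)
Lemma has_Rintegral_affine (R : realType) (f : R -> R) (a b A B k : R) : a <= b ->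
  {in `]a, b[, f =1 fun u => k * (A + B * u)} ->
  has_Rintegral R f a b (k * (b - a) * (A + B * ((a + b) / 2))).
Proof.
rewrite le_eqVlt => /predU1P[<- _|ab fE].
  rewrite subrr mulr0 mul0r; split; last by rewrite set_itv1 Rintegral_set1.
  rewrite set_itv1; apply: null_set_integrable => //; last exact: lebesgue_measure_set1.
  exact: measurable_fun_set1.
pose g (u : R) : R := k * (A + B * u).
pose F (u : R) : R := k * (A * u + B / 2 * u ^+ 2).
have cg : continuous g.
  move=> u; apply: cvgM; first exact: cvg_cst.
  by apply: cvgD; [exact: cvg_cst|apply: cvgM; [exact: cvg_cst|exact: cvg_id]].
have dF (u : R) : is_derive u (1 : R) F (g u).
  rewrite /F; apply: is_derive_eq; by rewrite /g /GRing.scale/=; field.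
have ig : (@lebesgue_measure R).-integrable `[a, b] (EFin \o g).
  apply: continuous_compact_integrable; first exact: segment_compact.
  exact: continuous_subspaceT.
have mg : measurable_fun `]a, b[ g.
  apply: measurable_funS (_ : measurable_fun `[a, b] g) => //; last first.
    by apply/measurable_EFinP; exact: measurable_int ig.
  exact: subset_itv_oo_cc.
have mf : measurable_fun `]a, b[ f.
  by apply: eq_measurable_fun mg => u /[!inE] uab; rewrite fE.
have mfc : measurable_fun `[a, b] f.
  by apply/measurable_fun_itv_bndo_bndcP/measurable_fun_itv_obnd_cbndP.
have I_F : (\int[@lebesgue_measure R]_(x in `[a, b]) (g x)%:E = (F b)%:E - (F a)%:E)%E.
  apply: continuous_FTC2 => //.
  - exact: continuous_subspaceT.
  - have cF : continuous F.
      move=> u; apply/differentiable_continuous/derivable1_diffP.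
      exact: ex_derive.
    split=> [u _||]; first exact: ex_derive.
    + by apply: cvg_at_right_filter; exact: cF.
    + by apply: cvg_at_left_filter; exact: cF.
  - by move=> u _; rewrite derive1E; apply: derive_val.
split.
  apply/integrableP; split; first exact/measurable_EFinP.
  have /integrableP[_] := ig; congr (_ < +oo)%E.
  rewrite integral_itv_bndoo; last first.
    by apply: measurableT_comp => //; exact/measurable_EFinP.
  rewrite [RHS]integral_itv_bndoo; last first.
    by apply: measurableT_comp => //; exact/measurable_EFinP.
  by apply: eq_integral => u /[!inE] uab /=; rewrite fE.
rewrite /Rintegral (@eq_integral_itv_bounded _ a b g f true false)// I_F -EFinB/=.
by rewrite /F; field.
Qed.

(** One coordinate of [dyadic_interpolation], for an arbitrary step [h]. *)
Definition interp (R : realType) (h : R) (x : R -> R) (u : R) : R :=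
  let l : R := (Num.floor (u / h))%:~R in
  x (l * h) + (u / h - l) * (x ((l + 1) * h) - x (l * h)).

Definition grid (R : realType) (h : R) (x : R -> R) (l : nat) : R := x (l%:R * h).

(** The right end of the cell is included: there the floor jumps to [l.+1], but both affine formulas
    return the grid value. *)
Lemma interp_cell (R : realType) (h : R) (x : R -> R) (l : nat) (u : R) : 0 < h ->
  l%:R * h <= u <= l.+1%:R * h ->
  interp R h x u =
    grid R h x l + (u / h - l%:R) * (grid R h x l.+1 - grid R h x l).
Proof.
move=> h0 /andP[lu]; rewrite le_eqVlt => /predU1P[->|ul].
  rewrite /interp mulfK ?gt_eqF//.
  have -> : Num.floor (l.+1%:R : R) = l.+1 :> int.
    by apply: floor_def; rewrite lexx /= rmorphD/= ltrDl ltr01.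
  rewrite /grid subrr mul0r addr0 -[X in X - _]natr1 [X in X - _]addrC addrK mul1r.
  by rewrite addrC subrK.
rewrite /interp; have -> : Num.floor (u / h) = l :> int.
  by apply: floor_def; rewrite ler_pdivlMr// lu/= rmorphD/= natr1 ltr_pdivrMr.
by rewrite /grid natr1.
Qed.

Lemma derive1_interp (R : realType) (h : R) (x : R -> R) (l : nat) (u : R) : 0 < h ->
  l%:R * h < u < l.+1%:R * h ->
  derive1 (interp R h x) u = (grid R h x l.+1 - grid R h x l) / h.
Proof.
move=> h0 lu.
rewrite derive1E (@near_eq_derive _ R R _ (fun v : R =>
  grid R h x l + (v / h - l%:R) * (grid R h x l.+1 - grid R h x l))); last first.
  near=> v; apply: interp_cell => //.
  suff : v \in `]l%:R * h, l.+1%:R * h[ by rewrite in_itv/= => /andP[/ltW -> /ltW ->].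
  near: v; apply: near_in_itvoo; by rewrite in_itv.
have D : is_derive u (1 : R) (fun v : R =>
  grid R h x l + (v / h - l%:R) * (grid R h x l.+1 - grid R h x l))
  ((grid R h x l.+1 - grid R h x l) / h).
  by apply: is_derive_eq; rewrite /GRing.scale/=; field; rewrite gt_eqF.
exact: derive_val.
Unshelve. all: by end_near. Qed.

Lemma has_Rintegral_interp_cell (R : realType) (h : R) (x y : R -> R) (l : nat)
    (a b c : R) : 0 < h -> l%:R * h <= a -> a <= b -> b <= l.+1%:R * h ->
  has_Rintegral R (fun u => (interp R h x u - c) * derive1 (interp R h y) u) a b
    (((interp R h x a + interp R h x b) / 2 - c) * (interp R h y b - interp R h y a)).
Proof.
move=> h0 la ab bl.
have bE z : interp R h z b =
    grid R h z l + (b / h - l%:R) * (grid R h z l.+1 - grid R h z l).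
  by apply: interp_cell => //; rewrite bl (le_trans la).
have aE z : interp R h z a =
    grid R h z l + (a / h - l%:R) * (grid R h z l.+1 - grid R h z l).
  by apply: interp_cell => //; rewrite la (le_trans ab).
set dx := grid R h x l.+1 - grid R h x l.
set dy := grid R h y l.+1 - grid R h y l.
have := @has_Rintegral_affine R
  (fun u => (interp R h x u - c) * derive1 (interp R h y) u) a b
  (grid R h x l - l%:R * dx - c) (dx / h) (dy / h) ab.
have -> : dy / h * (b - a) * (grid R h x l - l%:R * dx - c + dx / h * ((a + b) / 2)) =
  ((interp R h x a + interp R h x b) / 2 - c) * (interp R h y b - interp R h y a).
  by rewrite !aE !bE -/dx -/dy; field; rewrite gt_eqF.
apply=> u; rewrite in_itv/= => /andP[au ub].
rewrite (@derive1_interp _ _ _ l)//; last first.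
  by rewrite (le_lt_trans la)//= (lt_le_trans ub).
rewrite (@interp_cell _ _ _ l)//; last first.
  by rewrite (le_trans la (ltW au))//= (le_trans (ltW ub)).
by rewrite -/dx -/dy; field; rewrite gt_eqF.
Qed.

Definition mid_sum (R : realType) (x y : nat -> R) (p q : nat) : R :=
  \sum_(p <= l < q) ((x l + x l.+1) / 2 - x p) * (y l.+1 - y l).

Lemma interp_grid (R : realType) (h : R) (x : R -> R) (l : nat) : 0 < h ->
  interp R h x (l%:R * h) = grid R h x l.
Proof.
move=> h0; rewrite (@interp_cell _ _ _ l)// ?mulfK ?gt_eqF// ?subrr ?mul0r ?addr0//.
by rewrite lexx/= ler_pM2r// ler_nat.
Qed.

(** [mid_sum] is centred at the grid value at [p]; moving the centre to [c], later the off-grid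
    value at [s], costs one product of increments. *)
Lemma has_Rintegral_interp_grid (R : realType) (h : R) (x y : R -> R) (p q : nat)
    (c : R) : 0 < h -> (p <= q)%N ->
  has_Rintegral R (fun u => (interp R h x u - c) * derive1 (interp R h y) u)
    (p%:R * h) (q%:R * h)
    (mid_sum R (grid R h x) (grid R h y) p q +
     (grid R h x p - c) * (grid R h y q - grid R h y p)).
Proof.
move=> h0; elim: q => [|q IH].
  rewrite leqn0 => /eqP ->; rewrite /mid_sum big_geq// subrr mulr0 addr0.
  have := @has_Rintegral_interp_cell R h x y 0 (0%:R * h) (0%:R * h) c h0.
  rewrite subrr mulr0; apply => //; by rewrite ler_pM2r// ler_nat.
rewrite leq_eqVlt => /predU1P[->|]; last rewrite ltnS => pq.
  rewrite /mid_sum big_geq// subrr mulr0 addr0.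
  have := @has_Rintegral_interp_cell R h x y q.+1 (q.+1%:R * h) (q.+1%:R * h) c h0.
  rewrite subrr mulr0; apply => //; by rewrite ler_pM2r// ler_nat.
have -> : mid_sum R (grid R h x) (grid R h y) p q.+1 +
     (grid R h x p - c) * (grid R h y q.+1 - grid R h y p) =
   (mid_sum R (grid R h x) (grid R h y) p q +
     (grid R h x p - c) * (grid R h y q - grid R h y p)) +
   (((interp R h x (q%:R * h) + interp R h x (q.+1%:R * h)) / 2 - c) *
     (interp R h y (q.+1%:R * h) - interp R h y (q%:R * h))).
  by rewrite !interp_grid// /mid_sum big_nat_recr//=; field.
apply: has_RintegralD (IH pq) (@has_Rintegral_interp_cell _ h x y q _ _ c h0 _ _ _);
  by rewrite ?ler_pM2r ?ler_nat.
Qed.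

(* The level-[h] polygonal integral over [s, t], with [s] in the grid cell [k],
   [t] in the cell [q], [a] the fraction of the cell [k] to the right of [s]
   and [b] the fraction of the cell [q] to the left of [t]. *)
Definition interp_area (R : realType) (x y : nat -> R) (k q : nat) (a b : R) : R :=
  2^-1 * a ^+ 2 * ((x k.+1 - x k) * (y k.+1 - y k)) +
  a * ((x k.+1 - x k) * (y q - y k.+1)) +
  mid_sum R x y k.+1 q +
  b * ((x q - x k.+1) * (y q.+1 - y q)) +
  a * b * ((x k.+1 - x k) * (y q.+1 - y q)) +
  2^-1 * b ^+ 2 * ((x q.+1 - x q) * (y q.+1 - y q)).

Lemma Rintegral_interp (R : realType) (h : R) (x y : R -> R) (s t : R) (k q : nat) :
  0 < h -> k%:R * h <= s -> s <= k.+1%:R * h -> (k < q)%N ->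
  q%:R * h <= t -> t <= q.+1%:R * h ->
  \int[@lebesgue_measure R]_(u in `[s, t])
    ((interp R h x u - interp R h x s) * derive1 (interp R h y) u) =
  interp_area R (grid R h x) (grid R h y) k q (k.+1%:R - s / h) (t / h - q%:R).
Proof.
move=> h0 ks sk kq qt tq.
set c := interp R h x s.
have H1 := @has_Rintegral_interp_cell R h x y k s (k.+1%:R * h) c h0 ks sk (lexx _).
have H2 := @has_Rintegral_interp_grid R h x y k.+1 q c h0 kq.
have H3 := @has_Rintegral_interp_cell R h x y q (q%:R * h) t c h0 (lexx _) qt tq.
have kqh : k.+1%:R * h <= q%:R * h by rewrite ler_pM2r// ler_nat.
(* The interval is cut at the first grid point after [s] and the last one before [t]: partial cell,
   full cells, partial cell. *)
have [_ ->] := has_RintegralD _ _ _ _ _ _ _ (le_trans sk kqh) qt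
  (has_RintegralD _ _ _ _ _ _ _ sk kqh H1 H2) H3.
rewrite /c !interp_grid//.
rewrite !(@interp_cell R h _ k s) ?ks ?sk// !(@interp_cell R h _ q t) ?qt ?tq//.
rewrite /interp_area -[k.+1%:R]natr1.
set M := mid_sum _ _ _ _ _.
by field; rewrite gt_eqF.
Qed.

(** * Moments of the increments *)

Definition has_mean (R : realType) (disp : measure_display)
    (Omega : measurableType disp) (P : {measure set Omega -> \bar R})
    (f : Omega -> R) (v : R) : Prop :=
  P.-integrable setT (EFin \o f) /\ (\int[P]_w (f w)%:E = v%:E)%E.

Arguments has_mean {R disp Omega}.

Section HasMean.
Context {R : realType} {disp : measure_display} {Omega : measurableType disp}.
Variable P : {measure set Omega -> \bar R}.
Implicit Types f g : Omega -> R.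

Lemma has_meanD f g v w : has_mean P f v -> has_mean P g w ->
  has_mean P (fun x => f x + g x) (v + w).
Proof.
move=> [If Ef] [Ig Eg]; split; first exact: integrableD If Ig.
by rewrite (integralD_EFin measurableT If Ig) Ef Eg -EFinD.
Qed.

Lemma has_meanB f g v w : has_mean P f v -> has_mean P g w ->
  has_mean P (fun x => f x - g x) (v - w).
Proof.
move=> [If Ef] [Ig Eg]; split; first exact: integrableB If Ig.
by rewrite (integralB_EFin measurableT If Ig) Ef Eg -EFinB.
Qed.

Lemma has_mean0 : has_mean P (fun=> 0) 0.
Proof. by split; [exact: integrable0|rewrite integral0]. Qed.

Lemma has_mean_sum n (F : nat -> Omega -> R) (v : nat -> R) :
  (forall k, (k < n)%N -> has_mean P (F k) (v k)) ->
  has_mean P (fun x => \sum_(k < n) F k x) (\sum_(k < n) v k).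
Proof.
elim: n => [_|n IH h].
  rewrite big_ord0; under eq_fun do rewrite big_ord0; exact: has_mean0.
rewrite big_ord_recr; under eq_fun do rewrite big_ord_recr.
by apply: has_meanD; [apply: IH => k kn; apply: h; exact: ltnW|exact: h].
Qed.

End HasMean.

(* E (X_b - X_a) (X_d - X_c) for a fractional Brownian motion X with Hurst
   parameter alpha / 2. *)
Definition fbm_cov (R : realType) (alpha a b c d : R) : R :=
  2^-1 * (`|b - c| `^ alpha + `|a - d| `^ alpha
          - `|b - d| `^ alpha - `|a - c| `^ alpha).

Section FractionalIncrements.
Context {R : realType} {disp : measure_display} {Omega : measurableType disp}.
Variable P : probability Omega R.

(** Centredness turns covariances into second moments; when the product is expanded over the four
    times, the terms depending on a single time cancel. *)
Lemma fbm_increments_mean (T H : R) (d : nat) (B : R -> 'I_d -> {RV P >-> R}) (i : 'I_d) :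
  fractional_brownian_motion T H B ->
  forall a b c d, 0 <= a <= T -> 0 <= b <= T -> 0 <= c <= T -> 0 <= d <= T ->
  has_mean P (fun w => (B b i w - B a i w) * (B d i w - B c i w))
    (fbm_cov R (2 * H) a b c d).
Proof.
move=> [_ mean0 covE _] a b c e ha hb hc he.
have cov s t : 0 <= s <= T -> 0 <= t <= T ->
    (\int[P]_w (B s i w * B t i w)%:E =
     (2^-1 * (t `^ (2 * H) + s `^ (2 * H) - `|t - s| `^ (2 * H)))%:E)%E.
  move=> hs ht; rewrite -(covE s t i hs ht) covariance.unlock !mean0//= expectation.unlock.
  by apply: eq_integral => w _ /=; rewrite /GRing.mul /= !subr0.
have sqI s : 0 <= s <= T -> P.-integrable setT (fun w => (B s i w ^+ 2)%:E).
  move=> hs; apply/integrableP; split.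
    by apply/measurable_EFinP; exact: measurable_funX.
  under eq_integral do rewrite /= ger0_norm ?sqr_ge0// expr2.
  by rewrite cov// ltry.
have hm s t : 0 <= s <= T -> 0 <= t <= T -> has_mean P (fun w => B s i w * B t i w)
     (2^-1 * (t `^ (2 * H) + s `^ (2 * H) - `|t - s| `^ (2 * H))).
  move=> hs ht; split; last exact: cov.
  (* The product is dominated by the sum of the two squares, whose means are finite by the
     covariance formula on the diagonal. *)
  apply: (@le_integrable _ _ _ P setT measurableT _
      ((fun w => (B s i w ^+ 2)%:E) \+ (fun w => (B t i w ^+ 2)%:E))%E).
  - by apply/measurable_EFinP; exact: measurable_funM.
  - move=> w _; rewrite /= lee_fin [leRHS]ger0_norm ?addr_ge0 ?sqr_ge0// ler_norml.
    by apply/andP; split; nra.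
  - by apply: integrableD => //; exact: sqI.
have -> : fbm_cov R (2 * H) a b c e =
   (2^-1 * (e `^ (2 * H) + b `^ (2 * H) - `|e - b| `^ (2 * H))) -
   (2^-1 * (e `^ (2 * H) + a `^ (2 * H) - `|e - a| `^ (2 * H))) -
   (2^-1 * (c `^ (2 * H) + b `^ (2 * H) - `|c - b| `^ (2 * H))) +
   (2^-1 * (c `^ (2 * H) + a `^ (2 * H) - `|c - a| `^ (2 * H))).
  by rewrite /fbm_cov (distrC b c) (distrC a e) (distrC b e) (distrC a c); ring.
rewrite (_ : (fun w => _) = fun w => B b i w * B e i w - B a i w * B e i w
   - B b i w * B c i w + B a i w * B c i w); last by apply/funext => w; ring.
by apply: has_meanD; [apply: has_meanB; [apply: has_meanB|]|]; exact: hm.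
Qed.

(** The interface between the probabilistic hypotheses and the level estimates: a mixed fourth
    moment of increments factors into one covariance of [X] and one of [Y]. *)
Definition mixed_moments (T alpha beta : R) (X Y : R -> Omega -> R) : Prop :=
  forall a b c d a' b' c' d' : R,
    0 <= a <= T -> 0 <= b <= T -> 0 <= c <= T -> 0 <= d <= T ->
    0 <= a' <= T -> 0 <= b' <= T -> 0 <= c' <= T -> 0 <= d' <= T ->
  has_mean P (fun w => ((X b w - X a w) * (Y b' w - Y a' w)) *
                       ((X d w - X c w) * (Y d' w - Y c' w)))
    (fbm_cov R alpha a b c d * fbm_cov R beta a' b' c' d').

(** Each coordinate at a time in [0, T] is measurable for the generated sigma-algebra, and
    measurability is stable under differences and products. *)
Lemma generated_preimage_increments (T : R) (d : nat) (B : R -> 'I_d -> {RV P >-> R})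
    (r : 'I_d) (a b c e : R) (U : set R) :
  0 <= a <= T -> 0 <= b <= T -> 0 <= c <= T -> 0 <= e <= T -> measurable U ->
  generated_sigma_algebra [set ta : R * 'I_d | 0 <= ta.1 <= T]
    (fun ta => B ta.1 ta.2 : Omega -> R)
    ((fun w => (B b r w - B a r w) * (B e r w - B c r w)) @^-1` U).
Proof.
move=> ha hb hc he mU; rewrite /generated_sigma_algebra.
set G := \bigcup_(_ in _) _.
have mB t : 0 <= t <= T -> measurable_fun setT (B t r : g_sigma_algebraType G -> R).
  move=> ht _ V mV; apply: sub_sigma_algebra.
  by exists (t, r) => //=; exists V.
have : measurable_fun setT
   ((fun w => (B b r w - B a r w) * (B e r w - B c r w)) : g_sigma_algebraType G -> R).
  by apply: measurable_funM; apply: measurable_funB; exact: mB.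
by move=> /(_ measurableT U mU); rewrite setTI.
Qed.

Lemma independent_fbm_mixed_moments (T : R) (N d : nat) (H : 'I_N -> R)
    (B : 'I_N -> R -> 'I_d -> {RV P >-> R}) (i j : 'I_N) (r r' : 'I_d) :
  (forall k, fractional_brownian_motion T (H k) (B k)) ->
  independent_processes T B -> i != j ->
  mixed_moments T (2 * H i) (2 * H j) (fun t => B i t r) (fun t => B j t r').
Proof.
move=> hB hind ij a b c e a' b' c' e' ha hb hc he ha' hb' hc' he'.
have [If Ef] := @fbm_increments_mean _ _ _ _ r (hB i) a b c e ha hb hc he.
have [Ig Eg] := @fbm_increments_mean _ _ _ _ r' (hB j) a' b' c' e' ha' hb' hc' he'.
set f := (fun w => _) in If Ef; set g := (fun w => _) in Ig Eg.
have mf : measurable_fun setT f by apply: measurable_funM; exact: measurable_funB.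
have mg : measurable_fun setT g by apply: measurable_funM; exact: measurable_funB.
have [] := @integral_mul_independent R _ _ P (mfun_Sub (mem_set mf))
  (mfun_Sub (mem_set mg)) _ If Ig.
  move=> U V mU mV /=.
  (* Independence is a product rule over all [N] processes; the whole space at the other indices
     contributes factors 1. *)
  pose A k := if k == i then f @^-1` U else if k == j then g @^-1` V else setT.
  have := hind A; rewrite (bigD1 i)//= (bigD1 j) ?(eq_sym j)//= big1; last first.
    by move=> k /andP[ki kj]; rewrite /A (negbTE ki) (negbTE kj) probability_setT.
  rewrite /A eqxx eq_sym (negbTE ij) eqxx mule1 => <-.
    congr (P _); apply/seteqP; split => [w [fU gV] k _|w h]/=.
      by rewrite /=; case: eqP => // _; case: eqP.
    by split; [have := h i I; rewrite /= eqxx|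
               have := h j I; rewrite /= eq_sym (negbTE ij) eqxx].
  move=> k; case: eqP => [->|_]; first exact: generated_preimage_increments.
  case: eqP => [->|_]; first exact: generated_preimage_increments.
  rewrite /generated_sigma_algebra.
  exact: (@measurableT _ (g_sigma_algebraType _)).
move=> /= I E; split.
  by apply: eq_integrable I => // w _; rewrite /f /g /=; congr EFin; ring.
rewrite EFinM -Ef -Eg -E; apply: eq_integral => w _; rewrite /f /g /=; congr EFin; ring.
Qed.

End FractionalIncrements.

(** * Calculus of second-moment bounds *)

Definition sq_mean_le (R : realType) (disp : measure_display)
    (Omega : measurableType disp) (P : {measure set Omega -> \bar R})
    (Z : Omega -> R) (V : R) : Prop :=
  measurable_fun setT Z /\ (\int[P]_w (Z w ^+ 2)%:E <= V%:E)%E.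

Arguments sq_mean_le {R disp Omega}.

Section SqMean.
Context {R : realType} {disp : measure_display} {Omega : measurableType disp}.
Variable P : {measure set Omega -> \bar R}.
Implicit Types (Z W : Omega -> R) (V : R).

Lemma sq_mean_leW Z V V' : V <= V' -> sq_mean_le P Z V -> sq_mean_le P Z V'.
Proof. by move=> VV' [mZ ZV]; split=> //; rewrite (le_trans ZV) ?lee_fin. Qed.

Lemma sq_mean_le0 V : 0 <= V -> sq_mean_le P (fun=> 0) V.
Proof.
move=> V0; split; first exact: measurable_cst.
by under eq_integral do rewrite expr0n/=; rewrite integral0 lee_fin.
Qed.

Lemma sq_mean_leZ Z V c : `|c| <= 1 -> sq_mean_le P Z V ->
  sq_mean_le P (fun w => c * Z w) V.
Proof.
move=> c1 [mZ ZV]; split; first exact: measurable_funM.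
apply: le_trans ZV; apply: ge0_le_integral => //.
- by move=> w _; rewrite lee_fin sqr_ge0.
- by apply/measurable_EFinP/measurable_funX; exact: measurable_funM.
- by apply/measurable_EFinP; exact: measurable_funX.
- move=> w _; rewrite lee_fin exprMn ler_piMl ?sqr_ge0//.
  by rewrite -real_normK ?num_real// expr_le1.
Qed.

Lemma sq_mean_leD Z W V V' : sq_mean_le P Z V -> sq_mean_le P W V' ->
  sq_mean_le P (fun w => Z w + W w) (2 * (V + V')).
Proof.
move=> [mZ ZV] [mW WV]; split; first exact: measurable_funD.
have mZ2 : measurable_fun setT (fun w => (Z w ^+ 2)%:E).
  by apply/measurable_EFinP; exact: measurable_funX.
have mW2 : measurable_fun setT (fun w => (W w ^+ 2)%:E).
  by apply/measurable_EFinP; exact: measurable_funX.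
apply: (@le_trans _ _ (\int[P]_w (2%:E * ((Z w ^+ 2)%:E + (W w ^+ 2)%:E)))%E).
  apply: ge0_le_integral => //.
  - by move=> w _; rewrite lee_fin sqr_ge0.
  - by apply/measurable_EFinP/measurable_funX; exact: measurable_funD.
  - by apply: measurable_funeM; exact: emeasurable_funD.
  - move=> w _; rewrite -EFinD -EFinM lee_fin.
    by have := sqr_ge0 (Z w - W w); nra.
rewrite ge0_integralZl//; last 2 first.
- exact: emeasurable_funD.
- by move=> w _; rewrite -EFinD lee_fin addr_ge0 ?sqr_ge0.
rewrite ge0_integralD//; last 2 first.
- by move=> w _; rewrite lee_fin sqr_ge0.
- by move=> w _; rewrite lee_fin sqr_ge0.
by rewrite EFinM [(V + V')%:E]EFinD; apply: lee_wpmul2l; rewrite ?lee_fin//; exact: leeD.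
Qed.

Lemma sq_mean_leB Z W V V' : sq_mean_le P Z V -> sq_mean_le P W V' ->
  sq_mean_le P (fun w => Z w - W w) (2 * (V + V')).
Proof.
move=> hZ hW; have N1 : `|(-1 : R)| <= 1 by rewrite normrN normr1.
have := sq_mean_leD _ _ _ _ hZ (sq_mean_leZ _ _ _ N1 hW).
by under eq_fun do rewrite mulN1r.
Qed.

Lemma has_mean_sq_mean_le Z V : measurable_fun setT Z ->
  has_mean P (fun w => Z w ^+ 2) V -> sq_mean_le P Z V.
Proof. by move=> mZ [_ E]; split=> //; rewrite E. Qed.

End SqMean.

Section Moments.
Context {R : realType} {disp : measure_display} {Omega : measurableType disp}.
Variable P : probability Omega R.
Variables (T alpha beta : R) (X Y : R -> Omega -> R).
Hypothesis alpha0 : 0 < alpha.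
Hypothesis beta0 : 0 < beta.
Hypothesis mX : forall t, measurable_fun setT (X t).
Hypothesis mY : forall t, measurable_fun setT (Y t).
Hypothesis XY : mixed_moments P T alpha beta X Y.

Lemma fbm_cov_diag (g a b : R) : 0 < g -> fbm_cov R g a b a b = `|b - a| `^ g.
Proof.
move=> g0; rewrite /fbm_cov !subrr normr0 powR0 ?gt_eqF// !subr0 (distrC a b).
by field.
Qed.

Lemma increments_sq_mean_le (a b c d V : R) :
  0 <= a <= T -> 0 <= b <= T -> 0 <= c <= T -> 0 <= d <= T ->
  `|b - a| `^ alpha * `|d - c| `^ beta <= V ->
  sq_mean_le P (fun w => (X b w - X a w) * (Y d w - Y c w)) V.
Proof.
move=> ha hb hc hd hV; apply: sq_mean_leW hV _; apply: has_mean_sq_mean_le.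
  by apply: measurable_funM; exact: measurable_funB.
by rewrite -!fbm_cov_diag//; exact: XY.
Qed.

Lemma sum_increments_sq_mean_le (n : nat) (a b c d : nat -> R) (V : R) :
  (forall k, (k < n)%N -> [/\ 0 <= a k <= T, 0 <= b k <= T, 0 <= c k <= T & 0 <= d k <= T]) ->
  \sum_(k < n) \sum_(l < n)
    `|fbm_cov R alpha (a k) (b k) (a l) (b l)| * `|fbm_cov R beta (c k) (d k) (c l) (d l)| <= V ->
  sq_mean_le P (fun w => \sum_(k < n) (X (b k) w - X (a k) w) * (Y (d k) w - Y (c k) w)) V.
Proof.
move=> hn hV; pose F k w := (X (b k) w - X (a k) w) * (Y (d k) w - Y (c k) w).
have mF k : measurable_fun setT (F k).
  by apply: measurable_funM; exact: measurable_funB.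
apply: sq_mean_leW hV _.
apply: (@sq_mean_leW _ _ _ _ _ (\sum_(k < n) \sum_(l < n)
    fbm_cov R alpha (a k) (b k) (a l) (b l) * fbm_cov R beta (c k) (d k) (c l) (d l))).
  apply: ler_sum => k _; apply: ler_sum => l _; rewrite -normrM; exact: ler_norm.
apply: has_mean_sq_mean_le; first by apply: measurable_sum => k; exact: mF.
rewrite (_ : (fun w => _) = fun w => \sum_(k < n) \sum_(l < n) F k w * F l w); last first.
  apply/funext => w; rewrite expr2 mulr_suml; apply: eq_bigr => k _.
  by rewrite mulr_sumr.
apply: (@has_mean_sum _ _ _ P n (fun k w => \sum_(l < n) F k w * F l w)
  (fun k => \sum_(l < n) fbm_cov R alpha (a k) (b k) (a l) (b l) *
      fbm_cov R beta (c k) (d k) (c l) (d l))) => k kn.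
apply: (@has_mean_sum _ _ _ P n (fun l w => F k w * F l w)
  (fun l => fbm_cov R alpha (a k) (b k) (a l) (b l) *
      fbm_cov R beta (c k) (d k) (c l) (d l))) => l ln.
have [? ? ? ?] := hn k kn; have [? ? ? ?] := hn l ln.
exact: XY.
Qed.

End Moments.

(** * Sums of increment covariances *)

Lemma sum_dist_le (R : realType) (w : nat -> R) (n : nat) : (forall k, 0 <= w k) ->
  \sum_(k < n) \sum_(l < n) w ((k - l) + (l - k))%N <= 2 * n%:R * \sum_(m < n) w m.
Proof.
move=> w0; elim: n => [|n IH]; first by rewrite !big_ord0 mulr0.
rewrite big_ord_recr /=.
under eq_bigr do rewrite big_ord_recr /=.
rewrite big_split /= big_ord_recr /= subnn addn0.
(* With truncated subtraction [(k - l) + (l - k)] is the distance of [k] and [l]. The new row and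
   the new column each run through the distances 1 to [n], and the corner adds [w 0]. *)
have E1 : \sum_(k < n) w ((k - n) + (n - k))%N = \sum_(k < n) w k.+1.
  rewrite -(big_mkord xpredT (fun k => w ((k - n) + (n - k))%N)) big_nat_rev /= big_mkord.
  by apply: eq_bigr => k _; congr w; have := ltn_ord k; lia.
have E2 : \sum_(k < n) w ((n - k) + (k - n))%N = \sum_(k < n) w k.+1.
  by rewrite -E1; apply: eq_bigr => k _; congr w; lia.
rewrite E1 E2.
have E3 : \sum_(m < n.+1) w m = w 0%N + \sum_(k < n) w k.+1 by rewrite big_ord_recl.
have E4 : \sum_(m < n) w m <= \sum_(m < n.+1) w m by rewrite big_ord_recr/= lerDl.
apply: (@le_trans _ _ (2 * n%:R * \sum_(m < n.+1) w m + 2 * \sum_(m < n.+1) w m)); last first.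
  by rewrite -[n.+1%:R]natr1 mulrDr mulr1 mulrDl.
rewrite -addrA; apply: lerD.
  by apply: (le_trans IH); rewrite ler_wpM2l// mulr_ge0.
rewrite E3; have := w0 0%N; lra.
Qed.

(* Covariance of two unit increments, at distance [n], of a fractional Brownian
   motion with Hurst parameter [alpha / 2]. *)
Definition fgn_cov (R : realType) (alpha : R) (n : nat) : R :=
  2^-1 * (n.+1%:R `^ alpha + `|n%:R - 1| `^ alpha - 2 * n%:R `^ alpha).

(** Self-similarity extracts the power of [h], and stationarity of the increments leaves a function
    of the distance between the cells. *)
Lemma fbm_cov_grid (R : realType) (alpha h : R) (i k : nat) : 0 <= h ->
  fbm_cov R alpha (i%:R * h) (i.+1%:R * h) (k%:R * h) (k.+1%:R * h) =
  h `^ alpha * fgn_cov R alpha ((i - k) + (k - i))%N.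
Proof.
move=> h0; rewrite /fbm_cov /fgn_cov -!mulrBl !normrM !(ger0_norm h0) !powRM//.
have [ik|ki] := leqP i k.
- have kE : k = (i + (k - i))%N by rewrite subnKC.
  have -> : (i - k = 0)%N by apply/eqP.
  rewrite add0n; move: (k - i)%N kE => n ->.
  have -> : `|i.+1%:R - (i + n)%:R| = `|n%:R - 1| :> R.
    by rewrite distrC natrD -natr1; congr `| _ |; ring.
  have -> : `|i%:R - (i + n).+1%:R| = n.+1%:R :> R.
    by rewrite distrC -addnS natrD addrAC subrr add0r ger0_norm.
  have -> : `|i.+1%:R - (i + n).+1%:R| = n%:R :> R.
    by rewrite distrC -addSn natrD addrAC subrr add0r ger0_norm.
  have -> : `|i%:R - (i + n)%:R| = n%:R :> R.
    by rewrite distrC natrD addrAC subrr add0r ger0_norm.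
  ring.
- have iE : i = (k + (i - k))%N by rewrite subnKC// ltnW.
  have -> : (k - i = 0)%N by apply/eqP; exact: ltnW.
  rewrite addn0; move: (i - k)%N iE => n ->.
  have -> : `|(k + n).+1%:R - k%:R| = n.+1%:R :> R.
    by rewrite -addnS natrD addrAC subrr add0r ger0_norm.
  have -> : `|(k + n)%:R - k.+1%:R| = `|n%:R - 1| :> R.
    by rewrite natrD -natr1; congr `| _ |; ring.
  have -> : `|(k + n).+1%:R - k.+1%:R| = n%:R :> R.
    by rewrite -addSn natrD addrAC subrr add0r ger0_norm.
  have -> : `|(k + n)%:R - k%:R| = n%:R :> R.
    by rewrite natrD addrAC subrr add0r ger0_norm.
  ring.
Qed.

(** Concavity is read off from convexity of the inverse power [alpha^-1 >= 1], applied at the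
    alpha-th powers of [a] and [b]; raising both sides to the power [alpha] undoes it. *)
Lemma powR_midpoint_concave (R : realType) (alpha a b : R) : 0 < alpha <= 1 ->
  0 <= a -> 0 <= b -> a `^ alpha + b `^ alpha <= 2 * ((a + b) / 2) `^ alpha.
Proof.
move=> /andP[al0 al1] a0 b0.
have i1 : 1 <= alpha^-1 by rewrite invf_ge1.
have h0 : 0 <= (2^-1 : R) by lra.
have h1 : (2^-1 : R) <= 1 by lra.
have := @convex_powR R _ i1 (Itv01 h0 h1) (a `^ alpha) (b `^ alpha).
rewrite !inE /= !in_itv /= !andbT !powR_ge0 => /(_ isT isT).
rewrite convRE [X in X `^ _ <= _]convRE /= /unstable.onem -!powRrM !mulfV ?gt_eqF// !powRr1//.
have -> : (1 - 2^-1 : R) = 2^-1 by field.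
rewrite -!mulrDr => le1.
have p0 : 0 <= 2^-1 * (a `^ alpha + b `^ alpha).
  by rewrite mulr_ge0// addr_ge0// powR_ge0.
have : (2^-1 * (a `^ alpha + b `^ alpha)) `^ alpha^-1 `^ alpha <=
    (2^-1 * (a + b)) `^ alpha.
  apply: ge0_ler_powR => //; first exact: ltW.
  - by rewrite nnegrE powR_ge0.
  - by rewrite nnegrE mulr_ge0// addr_ge0.
rewrite -powRrM mulVf ?gt_eqF// powRr1// [(a + b) / 2]mulrC.
lra.
Qed.

Section RhoSum.
Context {R : realType}.
Variable alpha : R.
Hypothesis al : 0 < alpha <= 1.

(** Concavity makes these increments decrease; the covariance at a positive lag is half the
    difference of two consecutive ones, hence nonpositive. *)
Let D (m : nat) : R := m.+1%:R `^ alpha - m%:R `^ alpha.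

Let Ddec m : D m.+1 <= D m.
Proof.
have := @powR_midpoint_concave R alpha m%:R m.+2%:R al (ler0n _ _) (ler0n _ _).
have -> : (m%:R + m.+2%:R) / 2 = m.+1%:R :> R by rewrite -[m.+2%:R]natr1 -natr1; field.
rewrite /D; lra.
Qed.

Let Dge0 m : 0 <= D m.
Proof.
rewrite subr_ge0; apply: ge0_ler_powR; rewrite ?nnegrE ?ler0n ?ler_nat//.
by case/andP: al => /ltW.
Qed.

Let rhoS m : fgn_cov R alpha m.+1 = 2^-1 * (D m.+1 - D m).
Proof.
rewrite /fgn_cov /D; have -> : m.+1%:R - 1 = m%:R :> R by rewrite -natr1 addrK.
by rewrite ger0_norm//; ring.
Qed.

Let rho0 : fgn_cov R alpha 0 = 1.
Proof.
case/andP: al => a0 _.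
rewrite /fgn_cov powR0 ?gt_eqF// sub0r normrN1 powR1; lra.
Qed.

(** Bounding a one-step decrease of [D] by the two-step decrease makes the sum telescope. Only even
    lags matter, since half-cells on the same side of two coarse cells are an even number of fine
    steps apart. *)
Lemma fgn_cov_even_sum n : \sum_(m < n) `|fgn_cov R alpha (2 * m)| <= 3 / 2.
Proof.
case: n => [|n]; first by rewrite big_ord0.
suff : \sum_(m < n.+1) `|fgn_cov R alpha (2 * m)| <= 3 / 2 - 2^-1 * D (2 * n).+1.
  by move/le_trans; apply; rewrite lerBlDr lerDl mulr_ge0 ?Dge0.
elim: n => [|n IH].
  rewrite big_ord1 muln0 rho0 normr1.
  have := Ddec 0; have -> : D 0 = 1; last by lra.
  by rewrite /D powR1 powR0 ?subr0// gt_eqF//; case/andP: al.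
rewrite big_ord_recr /=; apply: (le_trans (lerD IH (lexx _))).
have -> : (2 * n.+1 = (2 * n).+2)%N by lia.
rewrite rhoS ler0_norm; last first.
  by rewrite pmulr_rle0// subr_le0.
have := Ddec (2 * n).+2; lra.
Qed.

End RhoSum.

(** The sum and the difference of the two increments have nonnegative second moments; the process
    itself thus supplies the inequality between powers. *)
Lemma fbm_cov_bound (R : realType) (disp : measure_display)
    (Omega : measurableType disp) (P : probability Omega R)
    (T H : R) (d : nat) (B : R -> 'I_d -> {RV P >-> R}) (i : 'I_d) :
  0 < H -> fractional_brownian_motion T H B ->
  forall a b c d, 0 <= a <= T -> 0 <= b <= T -> 0 <= c <= T -> 0 <= d <= T ->
  `|fbm_cov R (2 * H) a b c d| <= 2^-1 * (`|b - a| `^ (2 * H) + `|d - c| `^ (2 * H)).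
Proof.
move=> H0 hB a b c e ha hb hc he.
have m := @fbm_increments_mean _ _ _ P T H d B i hB.
have a0 : 0 < 2 * H by rewrite mulr_gt0.
have m1 := m a b a b ha hb ha hb; have m2 := m c e c e hc he hc he.
have m3 := m a b c e ha hb hc he; rewrite fbm_cov_diag// in m1; rewrite fbm_cov_diag// in m2.
have pos f v : (forall w, 0 <= f w) -> has_mean P f v -> 0 <= v.
  by move=> f0 [_ E]; rewrite -lee_fin -E; apply: integral_ge0 => w _; rewrite lee_fin.
have p1 : 0 <= `|b - a| `^ (2 * H) + `|e - c| `^ (2 * H)
    - fbm_cov R (2 * H) a b c e - fbm_cov R (2 * H) a b c e.
  apply: pos (has_meanB _ _ _ _ _ (has_meanB _ _ _ _ _ (has_meanD _ _ _ _ _ m1 m2) m3) m3) => w.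
  have := sqr_ge0 ((B b i w - B a i w) - (B e i w - B c i w)); nra.
have p2 : 0 <= `|b - a| `^ (2 * H) + `|e - c| `^ (2 * H)
    + fbm_cov R (2 * H) a b c e + fbm_cov R (2 * H) a b c e.
  apply: pos (has_meanD _ _ _ _ _ (has_meanD _ _ _ _ _ (has_meanD _ _ _ _ _ m1 m2) m3) m3) => w.
  have := sqr_ge0 ((B b i w - B a i w) + (B e i w - B c i w)); nra.
by rewrite ler_norml; apply/andP; split; lra.
Qed.

(** * Refining the grid *)

(** Chen's relation for the discrete integral. *)
Lemma mid_sum_split (R : realType) (x y : nat -> R) (p r q : nat) :
  (p <= r)%N -> (r <= q)%N ->
  mid_sum R x y p q =
  mid_sum R x y p r + mid_sum R x y r q + (x r - x p) * (y q - y r).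
Proof.
move=> pr rq; rewrite /mid_sum (big_cat_nat pr rq)/= -addrA; congr (_ + _).
have -> : y q - y r = \sum_(r <= l < q) (y l.+1 - y l) by rewrite telescope_sumr.
by rewrite mulr_sumr -big_split/=; apply: eq_bigr => l _; ring.
Qed.

Lemma mid_sum_short (R : realType) (x y : nat -> R) (p q : nat) :
  (p <= q)%N -> (q <= p.+1)%N ->
  mid_sum R x y p q = 2^-1 * ((x q - x p) * (y q - y p)).
Proof.
move=> pq qp; have [->|->] : q = p \/ q = p.+1 by lia.
  by rewrite /mid_sum big_geq// !subrr; ring.
by rewrite /mid_sum big_nat1; field.
Qed.

(* Refining the grid changes the sum by the Levy areas of the coarse cells. *)
Lemma mid_sum_double (R : realType) (x y : nat -> R) (p n : nat) :
  mid_sum R x y (2 * p) (2 * (p + n)) =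
  mid_sum R (fun l => x (2 * l)%N) (fun l => y (2 * l)%N) p (p + n) +
  2^-1 * (\sum_(k < n) (x (2 * (p + k)).+1 - x (2 * (p + k))%N) *
                       (y (2 * (p + k)).+2 - y (2 * (p + k)).+1) -
          \sum_(k < n) (x (2 * (p + k)).+2 - x (2 * (p + k)).+1) *
                       (y (2 * (p + k)).+1 - y (2 * (p + k))%N)).
Proof.
elim: n => [|n IH].
  by rewrite !big_ord0 addn0 /mid_sum !big_geq// subrr mulr0 addr0.
have -> : (2 * (p + n.+1) = (2 * (p + n)).+2)%N by lia.
rewrite !big_ord_recr/= addnS.
have E (u v : nat -> R) i j : (i <= j)%N -> mid_sum R u v i j.+1 =
    mid_sum R u v i j + ((u j + u j.+1) / 2 - u i) * (v j.+1 - v j).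
  by move=> ij; rewrite /mid_sum big_nat_recr.
rewrite !E; try lia.
rewrite IH; have -> : (2 * (p + n).+1 = (2 * (p + n)).+2)%N by lia.
by field.
Qed.

Section LevyExponent.
Context {R : realType}.
Variables alpha beta : R.
Hypothesis alpha_gt : 2^-1 < alpha.
Hypothesis beta_gt : 2^-1 < beta.
Hypothesis rho_alpha : forall n, `|fgn_cov R alpha n| <= 1.
Hypothesis rho_beta : forall n, `|fgn_cov R beta n| <= 1.

(** Up to the power [alpha + beta] of the step, this majorises the second moment of either sum of
    half-cell products over [n] coarse cells. *)
Let S (n : nat) : R := \sum_(k < n) \sum_(l < n)
  `|fgn_cov R alpha (2 * ((k - l) + (l - k)))| * `|fgn_cov R beta (2 * ((k - l) + (l - k)))|.

Let S_le_mass (w : nat -> R) n : (forall m, 0 <= w m) ->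
  (forall m, `|fgn_cov R alpha (2 * m)| * `|fgn_cov R beta (2 * m)| <= w m) ->
  S n <= 2 * n%:R * \sum_(m < n) w m.
Proof.
move=> w0 hw; apply: le_trans (sum_dist_le _ _ _ w0).
by apply: ler_sum => k _; apply: ler_sum => l _; exact: hw.
Qed.

Let S_le3n n : (alpha <= 1) || (beta <= 1) -> S n <= 3 * n%:R.
Proof.
have -> : 3 * n%:R = 2 * n%:R * (3 / 2) :> R by field.
case/orP => h1.
- apply: (@le_trans _ _ (2 * n%:R * \sum_(m < n) `|fgn_cov R alpha (2 * m)|)).
    apply: (S_le_mass (fun m => `|fgn_cov R alpha (2 * m)|)) => m; first exact: normr_ge0.
    by rewrite ler_piMr.
  rewrite ler_wpM2l ?mulr_ge0// fgn_cov_even_sum//; apply/andP; split => //.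
  by move: alpha_gt; lra.
- apply: (@le_trans _ _ (2 * n%:R * \sum_(m < n) `|fgn_cov R beta (2 * m)|)).
    apply: (S_le_mass (fun m => `|fgn_cov R beta (2 * m)|)) => m; first exact: normr_ge0.
    by rewrite ler_piMl.
  rewrite ler_wpM2l ?mulr_ge0// fgn_cov_even_sum//; apply/andP; split => //.
  by move: beta_gt; lra.
Qed.

Let S_le_sqr n : S n <= n%:R ^+ 2.
Proof.
apply: (@le_trans _ _ (\sum_(k < n) \sum_(l < n) (1 : R))).
  apply: ler_sum => k _; apply: ler_sum => l _; rewrite -[leRHS]mulr1.
  by apply: ler_pM.
by rewrite !sumr_const !card_ord -mulrnA -natrX mulnn.
Qed.

(* If [alpha <= 1] or [beta <= 1], one of the covariances is summable and the
   double sum is of order [n]; otherwise [alpha + beta > 2] and the trivial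
   bound [n ^ 2] is enough. *)
Lemma levy_exponent : exists eps : R, 0 < eps <= 2^-1 /\
  forall (n : nat) (h tau : R), 0 < h -> h <= tau -> n%:R * h <= tau ->
  h `^ (alpha + beta) * (\sum_(k < n) \sum_(l < n)
  `|fgn_cov R alpha (2 * ((k - l) + (l - k)))| * `|fgn_cov R beta (2 * ((k - l) + (l - k)))|)
   <= 3 * (tau `^ (alpha + beta) * (h / tau) `^ eps).
Proof.
(* A growth of order [g] in [n <= tau / h] costs the power [- g] of [h / tau], so the power
   [alpha + beta - g] is left; a smaller exponent is weaker because [h / tau <= 1]. *)
have key (g eps : R) (g0 : 0 <= g) (e : eps <= alpha + beta - g) (n : nat) (h tau : R) :
   0 < h -> h <= tau -> n%:R * h <= tau -> S n <= 3 * (n%:R `^ g) ->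
   h `^ (alpha + beta) * S n <= 3 * (tau `^ (alpha + beta) * (h / tau) `^ eps).
  move=> h0 ht nh Sn; have t0 : 0 < tau by exact: lt_le_trans ht.
  have u0 : 0 < h / tau by rewrite divr_gt0.
  have u1 : h / tau <= 1 by rewrite ler_pdivrMr// mul1r.
  have hE : h `^ (alpha + beta) = tau `^ (alpha + beta) * (h / tau) `^ (alpha + beta).
    by rewrite -powRM ?(ltW t0) ?(ltW u0)// mulrC divfK ?gt_eqF.
  rewrite hE -mulrA [leRHS]mulrCA ler_pM2l ?powR_gt0//.
  apply: (@le_trans _ _ ((h / tau) `^ (alpha + beta) * (3 * n%:R `^ g))).
    by rewrite ler_pM2l ?powR_gt0.
  rewrite mulrCA ler_pM2l//.
  have ng : n%:R `^ g <= (h / tau) `^ (- g).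
    rewrite powRN -[leRHS]mul1r ler_pdivlMr ?powR_gt0// -powRM ?(ltW u0)//.
    have le1 : n%:R * (h / tau) <= 1 by rewrite mulrA ler_pdivrMr// mul1r.
    apply: (@le_trans _ _ (1 `^ g)); last by rewrite powR1.
    by apply: ge0_ler_powR => //; rewrite nnegrE// mulr_ge0// ltW.
  apply: (@le_trans _ _ ((h / tau) `^ (alpha + beta) * (h / tau) `^ (- g))).
    by rewrite ler_pM2l ?powR_gt0.
  rewrite -powRD; last by apply/implyP => _; rewrite gt_eqF.
  by apply: ger_powR => //; rewrite u0.
have [h1|] := boolP ((alpha <= 1) || (beta <= 1)).
(* The cap at one half keeps [eps] below both [alpha] and [beta], as the products of single
   increments will require. *)
- exists (Num.min 2^-1 (alpha + beta - 1)); split.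
    rewrite lt_min ge_min lexx/= andbT; apply/andP; split; first lra.
    by move: alpha_gt beta_gt; lra.
  move=> n h tau h0 ht nh; apply: (key 1) => //; first by rewrite ge_min lexx orbT.
  by rewrite powRr1//; exact: S_le3n.
- rewrite negb_or -!ltNge => /andP[a1 b1].
  exists (Num.min 2^-1 (alpha + beta - 2)); split.
    rewrite lt_min ge_min lexx/= andbT; apply/andP; split; first lra.
    by move: a1 b1; lra.
  move=> n h tau h0 ht nh; apply: (key 2%:R) => //; first by rewrite ge_min lexx orbT.
  rewrite powR_mulrn//; apply: (le_trans (S_le_sqr n)).
  by rewrite ler_peMl ?sqr_ge0// ler1n.
Qed.

End LevyExponent.

(** * Second moments at a fixed level and between consecutive levels *)

Section LevelEstimates.
Context {R : realType} {disp : measure_display} {Omega : measurableType disp}.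
Variable P : probability Omega R.
Variables (T alpha beta : R) (X Y : R -> Omega -> R).
Hypothesis alpha_gt : 2^-1 < alpha.
Hypothesis beta_gt : 2^-1 < beta.
Hypothesis mX : forall t, measurable_fun setT (X t).
Hypothesis mY : forall t, measurable_fun setT (Y t).
Hypothesis XY : mixed_moments P T alpha beta X Y.

Variables (tau eps : R).
Hypothesis tau0 : 0 < tau.
Hypothesis eps_bounds : 0 < eps <= 2^-1.
Hypothesis levy : forall (n : nat) (h : R), 0 < h -> h <= tau -> n%:R * h <= tau ->
  h `^ (alpha + beta) * (\sum_(k < n) \sum_(l < n)
  `|fgn_cov R alpha (2 * ((k - l) + (l - k)))| * `|fgn_cov R beta (2 * ((k - l) + (l - k)))|)
   <= 3 * (tau `^ (alpha + beta) * (h / tau) `^ eps).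

Let alpha0 : 0 < alpha. Proof. by move: alpha_gt; lra. Qed.
Let beta0 : 0 < beta. Proof. by move: beta_gt; lra. Qed.

(** Common scale of all errors at step [h]: the target power of [tau] times a gain that decays
    geometrically along dyadic steps. *)
Definition level_bound (h : R) : R := tau `^ (alpha + beta) * (h / tau) `^ eps.

Lemma level_bound_ge0 h : 0 <= level_bound h.
Proof. by rewrite mulr_ge0// powR_ge0. Qed.

Lemma level_bound_le h h' : 0 < h -> h <= h' -> level_bound h <= level_bound h'.
Proof.
move=> h0 hh; rewrite ler_pM2l ?powR_gt0//.
have /andP[e0 _] := eps_bounds.
apply: ge0_ler_powR; rewrite ?nnegrE ?(ltW e0) ?divr_ge0 ?(ltW tau0) ?(ltW h0)//.
  by rewrite (le_trans _ hh)// ltW.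
by rewrite ler_pM2r// invr_gt0.
Qed.

(** One short factor suffices for the gain: its exponent exceeds one half, hence [eps], and
    [h / tau <= 1]. *)
Lemma powR_level_bound (h A B : R) : 0 < h -> h <= tau -> 0 <= A -> 0 <= B ->
  (A <= h /\ B <= tau) \/ (A <= tau /\ B <= h) ->
  A `^ alpha * B `^ beta <= level_bound h.
Proof.
move=> h0 ht A0 B0 AB; have /andP[e0 e1] := eps_bounds.
have u0 : 0 < h / tau by rewrite divr_gt0.
have u1 : h / tau <= 1 by rewrite ler_pdivrMr// mul1r.
have up g : 2^-1 < g -> h `^ g <= tau `^ g * (h / tau) `^ eps.
  move=> g1; have -> : h `^ g = tau `^ g * (h / tau) `^ g.
    by rewrite -powRM ?(ltW tau0) ?(ltW u0)// mulrC divfK ?gt_eqF.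
  rewrite ler_pM2l ?powR_gt0//; apply: ger_powR; first by rewrite u0.
  by rewrite (le_trans e1)// ltW.
have mono g (x y : R) : 0 < g -> 0 <= x -> x <= y -> x `^ g <= y `^ g.
  move=> g0 x0 xy; apply: ge0_ler_powR; rewrite ?nnegrE ?(ltW g0)//.
  exact: le_trans xy.
rewrite /level_bound powRD; last by apply/implyP => _; rewrite gt_eqF.
case: AB => -[Ah Bh].
- rewrite [leRHS]mulrAC; apply: ler_pM; rewrite ?powR_ge0//; last exact: mono.
  by apply: le_trans (up _ alpha_gt); exact: mono.
- rewrite -mulrA; apply: ler_pM; rewrite ?powR_ge0//; first exact: mono.
  by apply: le_trans (up _ beta_gt); exact: mono.
Qed.

Lemma grid_increments_sq_mean_le (h d : R) (i j k l : nat) : 0 < h -> h <= d -> d <= tau ->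
  (i <= j)%N -> (k <= l)%N -> j%:R * h <= T -> l%:R * h <= T ->
  ((j - i)%:R * h <= d /\ (l - k)%:R * h <= tau) \/
  ((j - i)%:R * h <= tau /\ (l - k)%:R * h <= d) ->
  sq_mean_le P (fun w => (grid R h (X ^~ w) j - grid R h (X ^~ w) i) *
                         (grid R h (Y ^~ w) l - grid R h (Y ^~ w) k))
    (level_bound d).
Proof.
move=> h0 hd dt ij kl jT lT H.
have inT m m' : (m <= m')%N -> m'%:R * h <= T -> 0 <= m%:R * h <= T.
  move=> mm mT; rewrite mulr_ge0 ?(ltW h0)//=; apply: le_trans mT.
  by rewrite ler_pM2r// ler_nat.
have dist m m' : (m <= m')%N -> `|m'%:R * h - m%:R * h| = (m' - m)%:R * h.
  by move=> mm; rewrite -mulrBl -natrB// ger0_norm// mulr_ge0// ltW.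
apply: (increments_sq_mean_le P T alpha beta X Y) => //; try exact: (inT _ _ (leqnn _));
  try exact: (inT _ _ ij); try exact: (inT _ _ kl).
rewrite !dist//; apply: powR_level_bound; rewrite ?mulr_ge0 ?(ltW h0)//; exact: lt_le_trans hd.
Qed.

(** By [mid_sum_double] the difference is half of a difference of two sums, each bounded by
    [3 * level_bound h] through [levy]; the constant is [2 * (3 + 3)], with the factor one half
    merely bounded by 1. *)
Lemma mid_sum_levy_sq_mean_le (h : R) (p n : nat) : 0 < h -> h <= tau ->
  n%:R * h <= tau -> (2 * (p + n))%:R * h <= T ->
  sq_mean_le P (fun w =>
    mid_sum R (grid R h (X ^~ w)) (grid R h (Y ^~ w)) (2 * p) (2 * (p + n)) -
    mid_sum R (grid R (2 * h) (X ^~ w)) (grid R (2 * h) (Y ^~ w)) p (p + n))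
   (12 * level_bound h).
Proof.
move=> h0 ht nh nT.
have inT m : (m <= 2 * (p + n))%N -> 0 <= m%:R * h <= T.
  move=> mm; rewrite mulr_ge0 ?(ltW h0)//=; apply: le_trans nT.
  by rewrite ler_pM2r// ler_nat.
(* The offsets choose the left or right half of each coarse cell, for [X] and [Y] separately; they
   cancel in the lags. *)
have cellsum (o o' : nat) : (o <= 1)%N -> (o' <= 1)%N -> sq_mean_le P (fun w => \sum_(k < n)
    (X ((2 * (p + k) + o).+1%:R * h) w - X ((2 * (p + k) + o)%:R * h) w) *
    (Y ((2 * (p + k) + o').+1%:R * h) w - Y ((2 * (p + k) + o')%:R * h) w)) (3 * level_bound h).
  move=> o1 o1'.
  apply: (@sum_increments_sq_mean_le _ _ _ P T alpha beta X Y mX mY XY n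
    (fun k => (2 * (p + k) + o)%:R * h) (fun k => (2 * (p + k) + o).+1%:R * h)
    (fun k => (2 * (p + k) + o')%:R * h) (fun k => (2 * (p + k) + o').+1%:R * h)).
    by move=> k kn; split; apply: inT; clear -kn o1 o1'; lia.
  apply: le_trans (levy n h h0 ht nh).
  rewrite mulr_sumr; apply: ler_sum => k _; rewrite mulr_sumr; apply: ler_sum => l _.
  rewrite !fbm_cov_grid ?(ltW h0)// !normrM !(ger0_norm (powR_ge0 _ _)).
  have E r : ((2 * (p + k) + r) - (2 * (p + l) + r) + ((2 * (p + l) + r) - (2 * (p + k) + r)) =
              2 * ((k - l) + (l - k)))%N by clear; lia.
  rewrite !E powRD; last by apply/implyP => _; rewrite gt_eqF.
  by rewrite mulrACA.
have half : `|2^-1 : R| <= 1 by rewrite ger0_norm; lra.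
have := sq_mean_leZ _ _ _ _ half (sq_mean_leB _ _ _ _ _ (cellsum 0 1 _ _) (cellsum 1 0 _ _)).
move=> /(_ isT isT isT isT).
rewrite (_ : 2 * _ = 12 * level_bound h); last by ring.
congr (sq_mean_le P _ _); apply/funext => w.
have EX (Z : R -> R) : (fun l => grid R h Z (2 * l)) = grid R (2 * h) Z.
  by apply/funext => l; rewrite /grid natrM; congr Z; ring.
rewrite mid_sum_double !EX [X in _ = X - _]addrC addrK /grid; congr (_ * (_ - _)).
  by apply: eq_bigr => k _; rewrite !addn0 !addn1.
by apply: eq_bigr => k _; rewrite !addn0 !addn1.
Qed.

Definition boundary_terms (x y : nat -> R) (k q : nat) (a b : R) : R :=
  2^-1 * a ^+ 2 * ((x k.+1 - x k) * (y k.+1 - y k)) +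
  a * ((x k.+1 - x k) * (y q - y k.+1)) +
  b * ((x q - x k.+1) * (y q.+1 - y q)) +
  a * b * ((x k.+1 - x k) * (y q.+1 - y q)) +
  2^-1 * b ^+ 2 * ((x q.+1 - x q) * (y q.+1 - y q)).

Lemma interp_areaE (x y : nat -> R) (k q : nat) (a b : R) :
  interp_area R x y k q a b = boundary_terms x y k q a b + mid_sum R x y k.+1 q.
Proof. by rewrite /interp_area /boundary_terms; ring. Qed.

(** Each of the five terms contains an increment over one cell. If the grid point [q.+1] lies beyond
    [T], no moment is available there, but [b = 0] kills the terms involving it. Adding one by one
    gives the constants 4, 10, 22, 46. *)
Lemma boundary_sq_mean_le (h : R) (k q : nat) (a b : R) : 0 < h -> h <= tau ->
  (k < q)%N -> q%:R * h <= T -> (q - k.+1)%:R * h <= tau ->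
  0 <= a <= 1 -> 0 <= b <= 1 -> (b = 0 \/ q.+1%:R * h <= T) ->
  sq_mean_le P (fun w => boundary_terms (grid R h (X ^~ w)) (grid R h (Y ^~ w)) k q a b)
    (46 * level_bound h).
Proof.
move=> h0 ht kq qT qk /andP[a0 a1] /andP[b0 b1] bT.
have kT : k.+1%:R * h <= T by apply: le_trans qT; rewrite ler_pM2r// ler_nat.
have one m : (m.+1 - m)%:R * h <= h by rewrite subSnn mul1r.
have short m : (m.+1 - m)%:R * h <= tau by exact: le_trans (one m) ht.
have V0 := level_bound_ge0 h.
have term c (F : Omega -> R) : `|c| <= 1 -> (c = 0 \/ sq_mean_le P F (level_bound h)) ->
    sq_mean_le P (fun w => c * F w) (level_bound h).
  move=> c1 [->|hF]; last exact: sq_mean_leZ.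
  by under eq_fun do rewrite mul0r; exact: sq_mean_le0.
have a2 : a ^+ 2 <= 1 by rewrite expr_le1.
have b2 : b ^+ 2 <= 1 by rewrite expr_le1.
have a2' := sqr_ge0 a; have b2' := sqr_ge0 b.
have t1 : sq_mean_le P (fun w => 2^-1 * a ^+ 2 *
    ((grid R h (X ^~ w) k.+1 - grid R h (X ^~ w) k) *
     (grid R h (Y ^~ w) k.+1 - grid R h (Y ^~ w) k))) (level_bound h).
  apply: term; first by rewrite ger0_norm; lra.
  by right; apply: grid_increments_sq_mean_le => //; left.
have t2 : sq_mean_le P (fun w => a *
    ((grid R h (X ^~ w) k.+1 - grid R h (X ^~ w) k) *
     (grid R h (Y ^~ w) q - grid R h (Y ^~ w) k.+1))) (level_bound h).
  apply: term; first by rewrite ger0_norm.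
  by right; apply: grid_increments_sq_mean_le => //; left.
have t3 : sq_mean_le P (fun w => b *
    ((grid R h (X ^~ w) q - grid R h (X ^~ w) k.+1) *
     (grid R h (Y ^~ w) q.+1 - grid R h (Y ^~ w) q))) (level_bound h).
  apply: term; first by rewrite ger0_norm.
  case: bT => [->|q1T]; [by left|right].
  by apply: grid_increments_sq_mean_le => //; right.
have t4 : sq_mean_le P (fun w => a * b *
    ((grid R h (X ^~ w) k.+1 - grid R h (X ^~ w) k) *
     (grid R h (Y ^~ w) q.+1 - grid R h (Y ^~ w) q))) (level_bound h).
  apply: term; first by rewrite ger0_norm ?mulr_ge0// mulr_ile1.
  case: bT => [->|q1T]; [by left; rewrite mulr0|right].
  by apply: grid_increments_sq_mean_le => //; left.
have t5 : sq_mean_le P (fun w => 2^-1 * b ^+ 2 *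
    ((grid R h (X ^~ w) q.+1 - grid R h (X ^~ w) q) *
     (grid R h (Y ^~ w) q.+1 - grid R h (Y ^~ w) q))) (level_bound h).
  apply: term; first by rewrite ger0_norm; lra.
  case: bT => [->|q1T]; [by left; rewrite expr0n/= mulr0|right].
  by apply: grid_increments_sq_mean_le => //; left.
have := sq_mean_leD _ _ _ _ _ (sq_mean_leD _ _ _ _ _ (sq_mean_leD _ _ _ _ _
  (sq_mean_leD _ _ _ _ _ t1 t2) t3) t4) t5.
apply: sq_mean_leW; lra.
Qed.

Lemma mid_sum_short_sq_mean_le (h : R) (p q : nat) : 0 < h -> h <= tau ->
  (p <= q)%N -> (q <= p.+1)%N -> q%:R * h <= T ->
  sq_mean_le P (fun w => mid_sum R (grid R h (X ^~ w)) (grid R h (Y ^~ w)) p q)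
    (level_bound h).
Proof.
move=> h0 ht pq qp qT; under eq_fun do rewrite mid_sum_short//.
apply: sq_mean_leZ; first by rewrite ger0_norm; lra.
have one : (q - p)%:R * h <= h by rewrite ler_piMl ?(ltW h0)// lern1; clear -pq qp; lia.
by apply: grid_increments_sq_mean_le => //; left; split => //; exact: le_trans ht.
Qed.

(** The full fine cells may overhang the full coarse ones by one cell at each end. Chen's relation
    at [2 * k.+1] and [2 * q] isolates these overhangs and two cross products; the middle is the
    area term. The constant is [2 * (22 + 12)]. *)
Lemma mid_sum_refine_sq_mean_le (h : R) (k q k' q' : nat) : 0 < h -> h <= tau ->
  (k < q)%N -> (2 * k <= k' <= (2 * k).+1)%N -> (2 * q <= q' <= (2 * q).+1)%N ->
  q'%:R * h <= T -> (q' - k'.+1)%:R * h <= tau ->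
  sq_mean_le P (fun w =>
    mid_sum R (grid R h (X ^~ w)) (grid R h (Y ^~ w)) k'.+1 q' -
    mid_sum R (grid R (2 * h) (X ^~ w)) (grid R (2 * h) (Y ^~ w)) k.+1 q)
   (68 * level_bound h).
Proof.
move=> h0 ht kq /andP[k1 k2] /andP[q1 q2] qT qk.
have [n qE] : exists n, q = (k.+1 + n)%N by exists (q - k.+1)%N; clear -kq; lia.
have leT m : (m <= q')%N -> m%:R * h <= T.
  by move=> mq; apply: le_trans qT; rewrite ler_pM2r// ler_nat.
have letau m : (m <= q' - k'.+1)%N -> m%:R * h <= tau.
  by move=> mq; apply: le_trans qk; rewrite ler_pM2r// ler_nat.
have leh m : (m <= 1)%N -> m%:R * h <= h.
  by move=> m1; rewrite ler_piMl ?(ltW h0)// lern1.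
pose x w := grid R h (X ^~ w); pose y w := grid R h (Y ^~ w).
have t1 : sq_mean_le P (fun w => mid_sum R (x w) (y w) k'.+1 (2 * k.+1)) (level_bound h).
  apply: mid_sum_short_sq_mean_le => //; [by clear -kq k1 k2 q1 q2 qE; lia|by clear -kq k1 k2 q1 q2 qE; lia|].
  by apply: leT; clear -kq k1 k2 q1 q2 qE; lia.
have t2 : sq_mean_le P (fun w => mid_sum R (x w) (y w) (2 * q) q') (level_bound h).
  by apply: mid_sum_short_sq_mean_le.
have t3 : sq_mean_le P (fun w => (x w (2 * k.+1)%N - x w k'.+1) *
    (y w q' - y w (2 * k.+1)%N)) (level_bound h).
  apply: grid_increments_sq_mean_le => //; [by clear -kq k1 k2 q1 q2 qE; lia|by clear -kq k1 k2 q1 q2 qE; lia| |].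
    by apply: leT; clear -kq k1 k2 q1 q2 qE; lia.
  by left; split; [apply: leh|apply: letau]; clear -kq k1 k2 q1 q2 qE; lia.
have t4 : sq_mean_le P (fun w => (x w (2 * q)%N - x w (2 * k.+1)%N) *
    (y w q' - y w (2 * q)%N)) (level_bound h).
  apply: grid_increments_sq_mean_le => //; [by clear -kq k1 k2 q1 q2 qE; lia| |].
    by apply: leT; clear -kq k1 k2 q1 q2 qE; lia.
  by right; split; [apply: letau|apply: leh]; clear -kq k1 k2 q1 q2 qE; lia.
have t5 := mid_sum_levy_sq_mean_le h k.+1 n h0 ht (letau n _) (leT (2 * (k.+1 + n))%N _).
have {t5} t5 := t5 ltac:(clear -kq k1 k2 q1 q2 qE; lia) ltac:(clear -kq k1 k2 q1 q2 qE; lia).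
have := sq_mean_leD _ _ _ _ _ (sq_mean_leD _ _ _ _ _ (sq_mean_leD _ _ _ _ _
  (sq_mean_leD _ _ _ _ _ t1 t2) t3) t4) t5.
rewrite [X in sq_mean_le _ _ X](_ : _ = 68 * level_bound h); last by ring.
congr (sq_mean_le P _ _); apply/funext => w; rewrite -/(x w) -/(y w) -qE.
rewrite (@mid_sum_split _ (x w) (y w) k'.+1 (2 * k.+1) q'); try (clear -kq k1 k2 q1 q2 qE; lia).
rewrite (@mid_sum_split _ (x w) (y w) (2 * k.+1) (2 * q) q'); try (clear -kq k1 k2 q1 q2 qE; lia).
ring.
Qed.

(** The boundary terms of both levels are small on their own and need not be compared; the constant
    is [2 * (2 * (46 + 46) + 68)]. *)
Lemma interp_area_refine_sq_mean_le (h : R) (k q k' q' : nat) (a b a' b' : R) :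
  0 < h -> 2 * h <= tau ->
  (k < q)%N -> (2 * k <= k' <= (2 * k).+1)%N -> (2 * q <= q' <= (2 * q).+1)%N ->
  (k' < q')%N ->
  q'%:R * h <= T -> (q' - k'.+1)%:R * h <= tau ->
  0 <= a <= 1 -> 0 <= b <= 1 -> (b = 0 \/ q.+1%:R * (2 * h) <= T) ->
  0 <= a' <= 1 -> 0 <= b' <= 1 -> (b' = 0 \/ q'.+1%:R * h <= T) ->
  sq_mean_le P (fun w =>
    interp_area R (grid R h (X ^~ w)) (grid R h (Y ^~ w)) k' q' a' b' -
    interp_area R (grid R (2 * h) (X ^~ w)) (grid R (2 * h) (Y ^~ w)) k q a b)
   (504 * level_bound (2 * h)).
Proof.
move=> h0 ht kq k1 q1 kq' qT qk ha hb hbT ha' hb' hbT'.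
have ht' : h <= tau by move: ht h0; lra.
have h20 : 0 < 2 * h by rewrite mulr_gt0.
have hh : level_bound h <= level_bound (2 * h) by apply: level_bound_le => //; move: h0; lra.
have e' := boundary_sq_mean_le h k' q' a' b' h0 ht' kq' qT qk ha' hb' hbT'.
have dbl m : m%:R * (2 * h) = (2 * m)%:R * h by rewrite natrM; ring.
have qT2 : q%:R * (2 * h) <= T.
  by rewrite dbl; apply: le_trans qT; rewrite ler_pM2r// ler_nat; clear -q1; lia.
have qk2 : (q - k.+1)%:R * (2 * h) <= tau.
  by rewrite dbl; apply: le_trans qk; rewrite ler_pM2r// ler_nat; clear -q1 k1 kq; lia.
have e := boundary_sq_mean_le (2 * h) k q a b h20 ht kq qT2 qk2 ha hb hbT.
have m := mid_sum_refine_sq_mean_le h k q k' q' h0 ht' kq k1 q1 qT qk.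
have := sq_mean_leD _ _ _ _ _ (sq_mean_leB _ _ _ _ _ e' e) m.
under eq_fun do rewrite addrACA -opprD -!interp_areaE.
apply: sq_mean_leW; move: hh; lra.
Qed.

Lemma interp_area_base_sq_mean_le (h : R) (k q : nat) (a b : R) :
  0 < h -> h <= tau -> (k < q)%N -> (q <= k.+2)%N -> q%:R * h <= T ->
  0 <= a <= 1 -> 0 <= b <= 1 -> (b = 0 \/ q.+1%:R * h <= T) ->
  sq_mean_le P (fun w =>
    interp_area R (grid R h (X ^~ w)) (grid R h (Y ^~ w)) k q a b)
   (94 * level_bound h).
Proof.
move=> h0 ht kq qk qT ha hb hbT.
have qkt : (q - k.+1)%:R * h <= tau.
  by apply: le_trans ht; rewrite ler_piMl ?(ltW h0)// lern1; clear -kq qk; lia.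
have e := boundary_sq_mean_le h k q a b h0 ht kq qT qkt ha hb hbT.
have m := mid_sum_short_sq_mean_le h k.+1 q h0 ht kq qk qT.
have := sq_mean_leD _ _ _ _ _ e m.
under eq_fun do rewrite -interp_areaE.
by apply: sq_mean_leW; lra.
Qed.

End LevelEstimates.

(** * Convergence along dyadic grids *)

Section TruncatedGrid.
Context {R : realType}.
Variables (T s t h : R) (M : nat).
Hypothesis h0 : 0 < h.
Hypothesis MT : M%:R * h = T.
Hypothesis s0 : 0 <= s.
Hypothesis st : h <= t - s.
Hypothesis tT : t <= T.
Let k := Num.truncn (s / h).
Let q := Num.truncn (t / h).

Let sh0 : 0 <= s / h. Proof. by rewrite divr_ge0// ltW. Qed.
Let th0 : 0 <= t / h. Proof. by rewrite divr_ge0 ?(ltW h0)//; move: st s0 h0; lra. Qed.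

Lemma truncn_grid : k%:R * h <= s < k.+1%:R * h /\ q%:R * h <= t < q.+1%:R * h.
Proof.
have /andP[k1 k2] := truncn_itv sh0; have /andP[q1 q2] := truncn_itv th0.
by rewrite -!ler_pdivlMr// -!ltr_pdivrMr// k1 k2 q1 q2.
Qed.

Lemma truncn_grid_lt : (k < q)%N.
Proof.
rewrite truncn_ge_nat// ler_pdivlMr// -natr1 mulrDl mul1r.
by have [/andP[+ _] _] := truncn_grid; move: st; lra.
Qed.

Lemma truncn_grid_le_end : q%:R * h <= T.
Proof. by have [_ /andP[+ _]] := truncn_grid; move: tT; lra. Qed.

Lemma truncn_grid_length : (q - k.+1)%:R * h <= t - s.
Proof.
rewrite natrB; last exact: truncn_grid_lt.
by have [/andP[_ +] /andP[+ _]] := truncn_grid; rewrite mulrBl; lra.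
Qed.

Lemma truncn_grid_left : 0 <= k.+1%:R - s / h <= 1.
Proof.
have /andP[k1 k2] := truncn_itv sh0; move: k2; rewrite -/k -natr1 => k2.
by apply/andP; split; [|move: k1; rewrite -/k]; lra.
Qed.

Lemma truncn_grid_right : 0 <= t / h - q%:R <= 1.
Proof.
have /andP[q1 q2] := truncn_itv th0; move: q2; rewrite -/q -natr1 => q2.
by apply/andP; split; [move: q1; rewrite -/q|]; lra.
Qed.

(** The next grid point leaves [0, T] only when [t] is itself the last grid point [T], and then its
    weight vanishes. *)
Lemma truncn_grid_end : t / h - q%:R = 0 \/ q.+1%:R * h <= T.
Proof.
have [qM|Mq] := ltnP q M; [right|left].
  by rewrite -MT ler_pM2r// ler_nat.
have : t / h <= q%:R.
  rewrite ler_pdivrMr//; apply: (le_trans tT); by rewrite -MT ler_pM2r// ler_nat.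
by have /andP[+ _] := truncn_grid_right; lra.
Qed.

End TruncatedGrid.

Lemma truncn_double (R : realType) (x : R) : 0 <= x ->
  (2 * Num.truncn x <= Num.truncn (2 * x) <= (2 * Num.truncn x).+1)%N.
Proof.
move=> x0; have /andP[k1 k2] := truncn_itv x0; move: k2; rewrite -natr1 => k2.
apply/andP; split.
  by rewrite truncn_ge_nat ?mulr_ge0// natrM ler_pM2l.
rewrite truncn_le_nat (_ : (2 * Num.truncn x).+2 = 2 * (Num.truncn x).+1)%N; last by rewrite mulnS.
by rewrite natrM ltr_pM2l// -natr1.
Qed.

Lemma exists_dyadic_scale (R : realType) (T tau : R) : 0 < tau -> tau <= T ->
  exists m : nat, T / 2 ^+ m <= tau < 2 * (T / 2 ^+ m).
Proof.
move=> tau0 tT; have T0 : 0 < T by exact: lt_le_trans tT.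
have ex : exists m : nat, T / 2 ^+ m <= tau.
  exists (Num.truncn (T / tau)).+1.
  rewrite ler_pdivrMr ?exprn_gt0// mulrC -ler_pdivrMr//.
  apply: (le_trans (ltW (truncnS_gt _))).
  by rewrite -natrX ler_nat ltnW// ltn_expl.
(* Minimality bounds [tau] from above by the preceding, doubled step; at level 0 the bound
   [tau <= T] takes over. *)
case: (ex_minnP ex) => -[|m] hm mmin.
  exists 0%N; rewrite hm/= expr0 divr1; apply: (le_lt_trans tT); lra.
exists m.+1; rewrite hm/=.
have : ~~ (T / 2 ^+ m <= tau) by apply/negP => /mmin; rewrite ltnn.
rewrite -ltNge exprS; congr (_ < _).
by field; rewrite expf_neq0.
Qed.

(** [C] is fixed before the horizon, the processes and the interval; it depends on the exponents
    alone, through [eps]. *)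
Lemma interp_integral_bound (R : realType) (alpha beta : R) :
  2^-1 < alpha -> 2^-1 < beta ->
  (forall n, `|fgn_cov R alpha n| <= 1) -> (forall n, `|fgn_cov R beta n| <= 1) ->
  exists C : R, 0 < C /\
  forall (T : R) (disp : measure_display) (Omega : measurableType disp)
    (P : probability Omega R) (X Y : R -> Omega -> R) (s t : R),
  0 < T ->
  (forall u, measurable_fun setT (X u)) -> (forall u, measurable_fun setT (Y u)) ->
  mixed_moments P T alpha beta X Y ->
  0 <= s -> s <= t -> t <= T ->
  exists S : Omega -> \bar R,
    [/\ measurable_fun setT S, (forall w, (0 <= S w)%E),
        (\int[P]_w S w <= (C * `|t - s| `^ (alpha + beta))%:E)%E &
        forall w, (S w < +oo)%E ->
          let I m := \int[@lebesgue_measure R]_(u in `[s, t])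
            ((interp R (T / 2 ^+ m) (X ^~ w) u - interp R (T / 2 ^+ m) (X ^~ w) s) *
             derive1 (interp R (T / 2 ^+ m) (Y ^~ w)) u) in
          cvg (I m @[m --> \oo]) /\ (((limn I) ^+ 2)%:E <= S w)%E].
Proof.
move=> al be ral rbe.
have [eps [eps_b levy]] := levy_exponent _ _ al be ral rbe.
have /andP[eps0 _] := eps_b.
(* Halving the step multiplies [level_bound] by [r ^+ 2], the form expected by the convergence
   lemma. *)
pose r : R := 2^-1 `^ (eps / 2).
have h01 : 0 < (2^-1 : R) < 1 by apply/andP; split; lra.
have /andP[h0 h1] := h01.
have r01 : 0 < r < 1.
  rewrite /r powR_gt0//=; have : 2^-1 `^ (eps / 2) < 1 `^ (eps / 2) :> R.
    by apply: gt0_ltr_powR; rewrite ?nnegrE ?(ltW h0)// divr_gt0.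
  by rewrite powR1.
have r2 : r ^+ 2 = 2^-1 `^ eps.
  by rewrite -powR_mulrn ?powR_ge0// -powRrM mulfVK.
pose C := (1 + (1 - r)^-1) ^+ 2 * 504.
exists C; split.
  apply: mulr_gt0; last by rewrite ltr0n.
  by rewrite exprn_gt0// ltr_pwDl// invr_ge0 subr_ge0 ltW//; case/andP: r01.
move=> T disp Omega P X Y s t T0 mX mY XY s0; rewrite le_eqVlt => /predU1P[<- _|st tT].
  exists (fun=> 0%E); split => //.
    rewrite integral0 lee_fin; apply: mulr_ge0; last exact: powR_ge0.
    by apply: mulr_ge0; [exact: sqr_ge0|exact: ler0n].
  move=> w _ /=; set I := fun m => _.
  have -> : I = fun=> 0 by apply/funext => m; rewrite /I set_itv1 Rintegral_set1.
  by split; [exact: is_cvg_cst|rewrite lim_cst// expr0n].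
pose tau := t - s; have tau0 : 0 < tau by rewrite subr_gt0.
have tauT : tau <= T by rewrite /tau; move: tT s0; lra.
have [m0 /andP[m0l m0u]] := exists_dyadic_scale _ _ _ tau0 tauT.
(* The levels are counted from [m0], the first one whose step is at most [tau]. *)
pose h n := T / 2 ^+ (m0 + n).
have hpos n : 0 < h n by rewrite divr_gt0// exprn_gt0.
have hS n : 2 * h n.+1 = h n.
  by rewrite /h addnS exprS; field; rewrite expf_neq0.
have hE n : h n = h 0%N * 2^-1 ^+ n.
  by rewrite /h addn0 exprD exprVn; field; rewrite !expf_neq0.
have hle n : h n <= tau.
  rewrite hE; apply: le_trans m0l; rewrite /h addn0 ler_piMr//.
    by rewrite ltW// divr_gt0// exprn_gt0.
  by rewrite exprn_ile1// ltW.
have hM n : (2 ^ (m0 + n))%:R * h n = T.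
  by rewrite natrX /h mulrC divfK// expf_neq0.
pose k n := Num.truncn (s / h n); pose q n := Num.truncn (t / h n).
pose a n := (k n).+1%:R - s / h n; pose b n := t / h n - (q n)%:R.
pose Z n w := interp_area R (grid R (h n) (X ^~ w)) (grid R (h n) (Y ^~ w))
  (k n) (q n) (a n) (b n).
have kq n : (k n < q n)%N by exact: truncn_grid_lt.
have aP n : 0 <= a n <= 1 by exact: truncn_grid_left.
have bP n : 0 <= b n <= 1 by apply: (truncn_grid_right s).
have bT n : b n = 0 \/ (q n).+1%:R * h n <= T.
  exact: (truncn_grid_end T s t (h n) (2 ^ (m0 + n))).
have qT n : (q n)%:R * h n <= T by apply: (truncn_grid_le_end T s t (h n)).
have qk n : (q n - (k n).+1)%:R * h n <= tau by apply: truncn_grid_length.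
have IZ n w : \int[@lebesgue_measure R]_(u in `[s, t])
            ((interp R (h n) (X ^~ w) u - interp R (h n) (X ^~ w) s) *
             derive1 (interp R (h n) (Y ^~ w)) u) = Z n w.
  have [/andP[k1 k2] /andP[q1 q2]] := truncn_grid s t (h n) (hpos n) s0 (hle n).
  by apply: Rintegral_interp => //; exact: ltW.
pose V : R := 504 * tau `^ (alpha + beta).
have V0 : 0 <= V by rewrite mulr_ge0 ?ler0n ?powR_ge0.
have bound n : level_bound alpha beta tau eps (h n) <= tau `^ (alpha + beta) * (r ^+ 2) ^+ n.
  have -> : (r ^+ 2) ^+ n = (2^-1 ^+ n) `^ eps.
    by rewrite r2 -powR_mulrn ?powR_ge0// -powRrM mulrC powRrM powR_mulrn// ltW.
  rewrite /level_bound ler_wpM2l ?powR_ge0//.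
  apply: ge0_ler_powR; first exact: ltW.
  - by rewrite nnegrE ltW// divr_gt0.
  - by rewrite nnegrE exprn_ge0// ltW.
  - by rewrite ler_pdivrMr// mulrC hE ler_pM2r ?exprn_gt0//; have := hle 0%N.
have sqZ0 : sq_mean_le P (Z 0%N) V.
  apply: (@sq_mean_leW _ _ _ _ _ (94 * level_bound alpha beta tau eps (h 0%N))).
    have := bound 0%N; rewrite expr0 mulr1 /V.
    have := powR_ge0 tau (alpha + beta); lra.
  apply: (interp_area_base_sq_mean_le P T) => //.
  (* Since [tau < 2 * h 0], at most one full cell fits between [s] and [t] at the starting level. *)
  rewrite truncn_le_nat ltr_pdivrMr//.
  have [/andP[_ k2] _] := truncn_grid s t (h 0%N) (hpos 0%N) s0 (hle 0%N).
  move: k2; rewrite -/(k 0%N) => k2.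
  have : t - s < 2 * h 0%N by rewrite /h addn0.
  rewrite -[(k 0%N).+3%:R]natr1 -[(k 0%N).+2%:R]natr1 !mulrDl !mul1r; move: k2; lra.
have sqZS n : sq_mean_le P (fun w => Z n.+1 w - Z n w) (V * (r ^+ 2) ^+ n).
  apply: (@sq_mean_leW _ _ _ _ _ (504 * level_bound alpha beta tau eps (2 * h n.+1))).
    by rewrite hS /V -mulrA ler_wpM2l ?ler0n ?bound.
  have dbl u : u / h n.+1 = 2 * (u / h n).
    by rewrite -(hS n); field; rewrite gt_eqF.
  have := interp_area_refine_sq_mean_le P T alpha beta X Y al be mX mY XY tau eps tau0
    eps_b (fun m g => levy m g tau) (h n.+1) (k n) (q n) (k n.+1) (q n.+1)
    (a n) (b n) (a n.+1) (b n.+1) (hpos n.+1).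
  rewrite !hS; apply => //.
  - by rewrite /k dbl; apply: truncn_double; rewrite divr_ge0// ltW.
  - rewrite /q dbl; apply: truncn_double; rewrite divr_ge0 ?(ltW (hpos n))//.
    by rewrite (le_trans s0)// ltW.
have mZ n : measurable_fun setT (Z n).
  elim: n => [|n IH]; first by case: sqZ0.
  have [mD _] := sqZS n.
  rewrite (_ : Z n.+1 = fun w => (Z n.+1 w - Z n w) + Z n w); last first.
    by apply/funext => w; rewrite subrK.
  exact: measurable_funD.
have [S [mS S0 SV Scvg]] := @ae_cvg_of_geometric_increments R _ _ P Z r V r01 V0 mZ
  (proj2 sqZ0) (fun n => proj2 (sqZS n)).
exists S; split => //.
  by apply: (le_trans SV); rewrite ger0_norm ?(ltW tau0)// lee_fin /C /V mulrA.
move=> w Sw /=; set I := fun m => _.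
have [Zc Zl] := Scvg w Sw.
have IZE : (fun n => I (n + m0)%N) = (Z ^~ w).
  by apply/funext => n; rewrite /I addnC IZ.
(* Shifting the sequence by [m0] leaves the limit unchanged. *)
have Ic : I m @[m --> \oo] --> limn (Z ^~ w).
  by rewrite -(cvg_shiftn m0) IZE.
split; first by apply: cvgP Ic.
by rewrite (cvg_lim _ Ic).
Qed.

(** [fbm_cov_bound] is read on the first and last of [n.+1] equal cells of [0, T]; both variances
    are the same power of [h], which divides out. *)
Lemma fgn_cov_le1 (R : realType) (disp : measure_display)
    (Omega : measurableType disp) (P : probability Omega R)
    (T H : R) (d : nat) (B : R -> 'I_d -> {RV P >-> R}) (i : 'I_d) (n : nat) :
  0 < T -> 0 < H -> fractional_brownian_motion T H B -> `|fgn_cov R (2 * H) n| <= 1.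
Proof.
move=> T0 H0 hB; pose h := T / n.+1%:R.
have h0 : 0 < h by rewrite divr_gt0.
have inT m : (m <= n.+1)%N -> 0 <= m%:R * h <= T.
  move=> mn; rewrite mulr_ge0 ?(ltW h0)//=.
  have -> : T = n.+1%:R * h by rewrite /h mulrC divfK// pnatr_eq0.
  by rewrite ler_pM2r// ler_nat.
have := fbm_cov_bound R _ _ P T H d B i H0 hB (0%:R * h) (1%:R * h) (n%:R * h) (n.+1%:R * h)
  (inT _ (leq0n _)) (inT 1%N isT) (inT _ (leqnSn _)) (inT _ (leqnn _)).
rewrite (@fbm_cov_grid _ _ _ 0 n) ?(ltW h0)// sub0n subn0 add0n -!mulrBl.
have -> : n.+1%:R - n%:R = 1 :> R by rewrite -natr1 addrAC subrr add0r.
rewrite subr0 mul1r (ger0_norm (ltW h0)) normrM (ger0_norm (powR_ge0 _ _)) => le1.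
have p0 : 0 < h `^ (2 * H) by rewrite powR_gt0.
rewrite -(ler_pM2l p0); apply: (le_trans le1); lra.
Qed.

(** * From scalar entries to the tensor-valued integral *)

Lemma matrix_cvgP (R : realType) (d : nat) (u : nat -> 'M[R]_d) :
  (forall a b, cvg (u m a b @[m --> \oo])) ->
  cvg (u m @[m --> \oo]) /\
  forall a b, (lim (u m @[m --> \oo])) a b = limn (fun m => u m a b).
Proof.
move=> uc; have c : cvg (u m @[m --> \oo]).
  apply/cvg_ex; exists (\matrix_(a, b) limn (fun m => u m a b)).
  move=> A [Q QM QA]; rewrite nbhs_simpl/=.
  have : \forall m \near \oo, forall a b, Q a b (u m a b).
    apply: filter_forall => a; apply: filter_forall => b.
    have := QM a b; rewrite mxE; exact: uc.
  by apply: filterS => m; exact: QA.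
split=> // a b; apply/esym/cvg_lim => //.
exact: (@cvg_comp _ _ _ u (fun M : 'M[R]_d => M a b) _ _ _ c (@coord_continuous R d d a b _)).
Qed.

Lemma dyadic_iterated_integralE (R : realType) (d : nat) (T : R) (x y : R -> 'rV[R]_d)
    (s t : R) (m : nat) (a b : 'I_d) :
  dyadic_iterated_integral T x y s t m a b =
  \int[@lebesgue_measure R]_(u in `[s, t])
    ((interp R (T / 2 ^+ m) (fun v => x v 0 a) u - interp R (T / 2 ^+ m) (fun v => x v 0 a) s) *
     derive1 (interp R (T / 2 ^+ m) (fun v => y v 0 b)) u).
Proof.
have E (z : R -> 'rV[R]_d) (c : 'I_d) u :
    dyadic_interpolation T m z u 0 c = interp R (T / 2 ^+ m) (fun v => z v 0 c) u.
  by rewrite /dyadic_interpolation /interp !mxE.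
rewrite /dyadic_iterated_integral /iterated_integral mxE.
rewrite (funext (E y b)); congr (Rintegral _ _ _); apply/funext => u.
by rewrite !E.
Qed.

Lemma tensor_norm_sqr (R : realType) (d : nat) (A : 'M[R]_d) :
  tensor_norm A ^+ 2 = \sum_a \sum_b A a b ^+ 2.
Proof.
rewrite /tensor_norm sqr_sqrtr//; apply: sumr_ge0 => a _; apply: sumr_ge0 => b _.
exact: sqr_ge0.
Qed.

Theorem proposition6p4 (R : realType) (N d : nat) (hN : (2 <= N)%N)
    (T : R) (hT : 0 < T)
    (disp : measure_display) (Omega : measurableType disp)
    (P : probability Omega R)
    (H : 'I_N -> R) (hH01 : forall k, 0 < H k < 1)
    (hHmin : forall k, 4^-1 < H k)
    (B : 'I_N -> R -> 'I_d -> {RV P >-> R})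
    (hB : forall k, fractional_brownian_motion T (H k) (B k))
    (hind : independent_processes T B)
    (i j : 'I_N) (hij : i != j) :
  exists C : R, 0 < C /\
    forall s t : R, 0 <= s -> s <= t -> t <= T ->
      {ae P, forall w, cvg (dyadic_iterated_integral T
        (sample_path (B i) w) (sample_path (B j) w) s t m @[m --> \oo])} /\
      ('E_P[fun w => (tensor_norm (rough_iterated_integral T
          (sample_path (B i) w) (sample_path (B j) w) s t) ^+ 2)%R]
        <= (C * `|t - s| `^ (2 * (H i + H j)))%:E)%E.
Proof.
have H0 k : 0 < H k by case/andP: (hH01 k).
have Hgt k : 2^-1 < 2 * H k by have := hHmin k; lra.
have [C0 [C0pos hC0]] : exists C : R, 0 < C /\ forall (a b : 'I_d) (s t : R),
    0 <= s -> s <= t -> t <= T ->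
    exists S : Omega -> \bar R,
    [/\ measurable_fun setT S, (forall w, (0 <= S w)%E),
        (\int[P]_w S w <= (C * `|t - s| `^ (2 * (H i + H j)))%:E)%E &
        forall w, (S w < +oo)%E ->
          let I m := dyadic_iterated_integral T
            (sample_path (B i) w) (sample_path (B j) w) s t m a b in
          cvg (I m @[m --> \oo]) /\ (((limn I) ^+ 2)%:E <= S w)%E].
  (* The bound on [fgn_cov] comes from an actual component; for [d = 0] there is none, but also no
     entry to estimate. *)
  case: d B hB hind => [|d'] B' hB' hind'; first by exists 1; split => // -[].
  have rk k n : `|fgn_cov R (2 * H k) n| <= 1.
    exact: (fgn_cov_le1 R _ _ P T (H k) _ (B' k) ord0).
  have [C [Cpos hC]] := interp_integral_bound R _ _ (Hgt i) (Hgt j) (rk i) (rk j).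
  exists C; split => // a b s t s0 st tT.
  have XY := independent_fbm_mixed_moments P T _ _ H B' i j a b hB' hind' hij.
  have [S [mS S0 SC hS]] := hC T _ _ P (fun u => B' i u a) (fun u => B' j u b) s t hT
    (fun u => measurable_funPT _) (fun u => measurable_funPT _) XY s0 st tT.
  exists S; split => //; first by rewrite mulrDr.
  move=> w Sw /=; have := hS w Sw; rewrite /=.
  set I1 := fun m => _; set I2 := fun m => _; suff -> : I1 = I2 by [].
  apply/funext => m; rewrite /I1 /I2 dyadic_iterated_integralE.
  have E k (c : 'I_d'.+1) : (fun v => sample_path (B' k) w v 0 c) = (fun v => B' k v c w).
    by apply/funext => v; rewrite mxE.
  by rewrite !E.
(* Each of the [d * d] entries contributes [C0]; the extra 1 keeps the constant positive when
   [d = 0]. *)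
exists (C0 * (d * d)%:R + 1); split.
  by rewrite ltr_wpDl// mulr_ge0// ltW.
move=> s t s0 st tT.
have [S hS] := choice (fun ab : 'I_d * 'I_d => hC0 ab.1 ab.2 s t s0 st tT).
pose bnd := `|t - s| `^ (2 * (H i + H j)).
have bnd0 : 0 <= bnd by exact: powR_ge0.
pose S' w := (\sum_(a < d) \sum_(b < d) S (a, b) w)%E.
have S0 ab w : (0 <= S ab w)%E by case: (hS ab).
have mS ab : measurable_fun setT (S ab) by case: (hS ab).
have S'0 w : (0 <= S' w)%E by apply: sume_ge0 => a _; apply: sume_ge0.
have mS' : measurable_fun setT S'.
  by apply: emeasurable_sum => a; apply: emeasurable_sum.
have IS' : (\int[P]_w S' w <= (C0 * (d * d)%:R * bnd)%:E)%E.
  rewrite ge0_integral_sum//; last 2 first.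
  - by move=> a; apply: emeasurable_sum.
  - by move=> a w _; apply: sume_ge0.
  apply: (@le_trans _ _ (\sum_(a < d) \sum_(b < d) (C0 * bnd)%:E)%E).
    apply: lee_sum => a _; rewrite ge0_integral_sum//.
    by apply: lee_sum => b _; case: (hS (a, b)).
  rewrite !sumEFin lee_fin !sumr_const !card_ord -mulrnA -mulr_natr.
  by rewrite le_eqVlt; apply/orP; left; apply/eqP; ring.
(* The sum of the entrywise majorants has finite mean, so almost surely all of them are finite and
   every entry converges. *)
have fin : {ae P, forall w, (S' w < +oo)%E}.
  have : P.-integrable setT S'.
    apply/integrableP; split => //.
    under eq_integral do rewrite gee0_abs//.
    by apply: le_lt_trans IS' _; rewrite ltry.
  move/(integrable_ae measurableT); apply: filterS => w /(_ I).
  by rewrite ge0_fin_numE.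
have fin' w : (S' w < +oo)%E -> forall a b, (S (a, b) w < +oo)%E.
  move=> fw a b; apply: le_lt_trans fw; rewrite /S' (bigD1 a)//= (bigD1 b)//=.
  by rewrite -addeA leeDl// adde_ge0//; apply: sume_ge0 => // c _; apply: sume_ge0.
have good w : (S' w < +oo)%E ->
    cvg (dyadic_iterated_integral T
      (sample_path (B i) w) (sample_path (B j) w) s t m @[m --> \oo]) /\
    ((tensor_norm (rough_iterated_integral T
      (sample_path (B i) w) (sample_path (B j) w) s t) ^+ 2)%:E <= S' w)%E.
  move=> fw; have hab a b := let: And4 _ _ _ f := hS (a, b) in f w (fin' w fw a b).
  have [c l] := matrix_cvgP _ _ _ (fun a b => proj1 (hab a b)).
  split => //; rewrite tensor_norm_sqr -sumEFin; apply: lee_sum => a _.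
  rewrite -sumEFin; apply: lee_sum => b _; rewrite /rough_iterated_integral l.
  exact: (proj2 (hab a b)).
split.
  by apply: filterS fin => w fw; exact: (proj1 (good w fw)).
rewrite expectation.unlock.
apply: (@le_trans _ _ (\int[P]_w S' w)%E).
  apply: le_integral_ae_nonmeasurable => //.
    by move=> w; rewrite lee_fin sqr_ge0.
  by apply: filterS fin => w fw; exact: (proj2 (good w fw)).
apply: (le_trans IS'); rewrite lee_fin -/bnd mulrDl lerDl mul1r //.
Qed.
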